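(* Let $H$ be a real Hilbert space, $A\in\mathbb{R}^{n\times n}$, $B\in\mathbb{R}^{n\times m}$, $C\in\mathbb{R}^{p\times n}$, let $S:D(S)\subseteq H\to H$ be a densely defined (possibly unbounded) operator, and let $\Gamma\in\mathcal{L}(\mathbb{R}^p,H_{-1})$. Assume that: (i) $S$ generates a strongly continuous semigroup of contractions $(\mathbb{T}(t))_{t\ge 0}$ on $H$; (ii) $A$ is Hurwitz; (iii) the spectra of $S$ and $A$ are disjoint and nonempty. Let $M\in\mathcal{L}(\mathbb{R}^n,H)$ be the unique solution of the Sylvester equation $SM-MA=-\Gamma C$. Suppose in addition that: (vi) $S$ is skew-adjoint and has compact resolvent; (vii) the pair $(S^*,\Gamma^* )$ is approximately observable in infinite-time; (viii) for every eigenvalue $\mu$ of $S$, $$\operatorname{rank}\begin{pmatrix}A-\mu I_n & B\\ C & 0\end{pmatrix}=n+p.$$ Then the pair $(S,B^\top M^* )$ is approximately observable in infinite-time.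
   Context: Notation: $\mathcal{L}(H_1,H_2)$ is the space of bounded linear operators from $H_1$ to $H_2$. A matrix is Hurwitz if all its eigenvalues have negative real part. Spectra, eigenvalues and eigenvectors are understood over $\mathbb{C}$ (i.e. in the complexification of $H$). Space $H_{-1}$: for a fixed $\beta$ in the resolvent set of $S$, $H_{-1}$ is the completion of $H$ for the norm $\|w\|_{-1}=\|(\beta I_H-S)^{-1}w\|_H$; it is the dual of $D(S^* )$ with respect to the pivot space $H$. The operator $S$ extends to a bounded operator $H\to H_{-1}$, still denoted $S$. Accordingly, the adjoint of $\Gamma$ is $\Gamma^*\in\mathcal{L}(D(S^* ),\mathbb{R}^p)$, with $D(S^* )$ carrying its graph norm. Operator $M$: under (i)–(iii) there is a unique linear operator $M:\mathbb{R}^n\to H_{-1}$ solving $SM-MA=-\Gamma C$ ($S$ being the extension above), and $M$ takes values in $H$, so $M\in\mathcal{L}(\mathbb{R}^n,H)$; $M^*\in\mathcal{L}(H,\mathbb{R}^n)$ is its adjoint. Approximate observability in infinite-time: if $G$ (here $G=S$ or $G=S^*$) generates a strongly continuous semigroup $(\mathbb{T}_G(t))_{t\ge0}$ on $H$ and $\mathcal{C}$ is a linear operator in $\mathcal{L}(H,Y)$, or more generally in $\mathcal{L}(D(G),Y)$ with $D(G)$ carrying its graph norm, where $Y$ is a real Hilbert space, let $(\psi\zeta_0)(t)=\mathcal{C}\,\mathbb{T}_G(t)\zeta_0$ for $\zeta_0\in D(G)$, $t\ge0$. The pair $(G,\mathcal{C})$ is approximately observable in infinite-time if $\operatorname{Ker}\psi=\{0\}$,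 i.e. the only $\zeta_0\in D(G)$ with $\mathcal{C}\,\mathbb{T}_G(t)\zeta_0=0$ for all $t\ge0$ is $\zeta_0=0$. *)

(* Defs.v *)
From HB Require Import structures.
From mathcomp Require Import all_boot all_order all_algebra.
From mathcomp Require Import all_classical all_reals all_analysis.
From mathcomp Require Import complex ring lra.

Set Implicit Arguments.
Unset Strict Implicit.
Unset Printing Implicit Defensive.

Import Order.TTheory GRing.Theory Num.Theory.
Import numFieldNormedType.Exports.

Local Open Scope classical_set_scope.
Local Open Scope ring_scope.

(* Real Hilbert spaces: the norm of the complete normed module is the one
   induced by the inner product. *)
HB.mixin Record CompleteNormedModule_isHilbert (R : realType) H
    & CompleteNormedModule R H := {
  inner : H -> H -> R;
  innerC : forall x y : H, inner x y = inner y x;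
  inner_linearl : forall (a : R) (x y z : H),
    inner (a *: x + y) z = a * inner x z + inner y z;
  inner_norm : forall x : H, inner x x = `|x| ^+ 2;
}.

#[short(type="hilbertType")]
HB.structure Definition Hilbert (R : realType) :=
  {H of CompleteNormedModule R H & CompleteNormedModule_isHilbert R H}.

(* [Complexification x y] stands for x + i y; over a real Hilbert space H it is
   a normed R[i]-module with |x + i y|^2 = |x|^2 + |y|^2. *)
Record complexification (V : Type) := Complexification { cre : V; cim : V }.

Section ComplexificationTheory.
Variables (R : realType) (H : hilbertType R).
Local Notation HC := (complexification H).
Implicit Types (x y z : HC) (l k : R[i]).

Definition pair_of_complexification x := (cre x, cim x).
Definition complexification_of_pair (p : H * H) := Complexification p.1 p.2.
Lemma pair_of_complexificationK :
  cancel pair_of_complexification complexification_of_pair.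
Proof. by case. Qed.

HB.instance Definition _ := Choice.copy HC (can_type pair_of_complexificationK).

Definition addcx x y := Complexification (cre x + cre y) (cim x + cim y).
Definition oppcx x := Complexification (- cre x) (- cim x).
Definition zerocx : HC := Complexification 0 0.

Lemma addcxA : associative addcx.
Proof. by move=> x y z; rewrite /addcx /= !addrA. Qed.
Lemma addcxC : commutative addcx.
Proof.
by move=> x y; rewrite /addcx [cre x + _]addrC [cim x + _]addrC.
Qed.
Lemma add0cx : left_id zerocx addcx.
Proof. by case=> a b; rewrite /addcx /= !add0r. Qed.
Lemma addNcx : left_inverse zerocx oppcx addcx.
Proof. by move=> x; rewrite /addcx /= !addNr. Qed.

HB.instance Definition _ := GRing.isZmodule.Build HC addcxA addcxC add0cx addNcx.

Definition scalecx l x := Complexification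
  (complex.Re l *: cre x - complex.Im l *: cim x)
  (complex.Re l *: cim x + complex.Im l *: cre x).

Lemma scalecxA l k x : scalecx l (scalecx k x) = scalecx (l * k) x.
Proof.
case: l k x => [a b] [c d] [u v]; rewrite /scalecx /=.
congr Complexification;
  rewrite !scalerBr !scalerDr !scalerA !scalerBl !scalerDl ?opprD !addrA;
  by rewrite [LHS](ACl (1*4*2*3)).
Qed.
Lemma scale1cx : left_id 1 scalecx.
Proof. by case=> u v; rewrite /scalecx /= !scale1r !scale0r subr0 addr0. Qed.
Lemma scalecxDr : right_distributive scalecx +%R.
Proof.
move=> l x y; rewrite /scalecx /=; congr Complexification.
- by rewrite !scalerDr opprD addrACA.
- by rewrite !scalerDr addrACA.
Qed.
Lemma scalecxDl x : {morph scalecx^~ x : l k / l + k}.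
Proof.
move=> [a b] [c d]; rewrite /scalecx /=; congr Complexification.
- by rewrite !scalerDl opprD addrACA.
- by rewrite !scalerDl addrACA.
Qed.

HB.instance Definition _ := GRing.Zmodule_isLmodule.Build R[i] HC
  scalecxA scale1cx scalecxDr scalecxDl.

Lemma innerDl (u v w : H) : inner (u + v) w = inner u w + inner v w.
Proof. by rewrite -[u in LHS]scale1r inner_linearl mul1r. Qed.
Lemma innerZl a (u w : H) : inner (a *: u) w = a * inner u w.
Proof.
have inner0l : inner 0 w = 0 :> R.
  by apply: (addrI (inner 0 w)); rewrite -innerDl !addr0.
by rewrite -[a *: u in LHS]addr0 inner_linearl inner0l addr0.
Qed.
Lemma innerDr (u v w : H) : inner u (v + w) = inner u v + inner u w.
Proof. by rewrite !(innerC u) innerDl. Qed.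
Lemma innerZr a (u w : H) : inner u (a *: w) = a * inner u w.
Proof. by rewrite !(innerC u) innerZl. Qed.

Definition sqnormcx x : R := `|cre x| ^+ 2 + `|cim x| ^+ 2.
Definition normcx x : R[i] := (Num.sqrt (sqnormcx x))%:C%C.

Lemma sqnormcx_ge0 x : 0 <= sqnormcx x.
Proof. by rewrite addr_ge0 ?sqr_ge0. Qed.

Lemma normcxD x y : normcx (x + y) <= normcx x + normcx y.
Proof.
rewrite /normcx -rmorphD lecR.
have -> : sqnormcx (x + y) = `|cre x + cre y| ^+ 2 + `|cim x + cim y| ^+ 2 by [].
rewrite /sqnormcx.
have := ler_normD (cre x) (cre y); have := ler_normD (cim x) (cim y).
have := normr_ge0 (cre x + cre y); have := normr_ge0 (cim x + cim y).
move: `|cre x + cre y| `|cim x + cim y| => p q.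
have := normr_ge0 (cre x); have := normr_ge0 (cim x).
have := normr_ge0 (cre y); have := normr_ge0 (cim y).
move: `|cre x| `|cim x| `|cre y| `|cim y| => a b c d d0 c0 b0 a0 q0 p0 qbd pac.
have ab0 : 0 <= a ^+ 2 + b ^+ 2 by rewrite addr_ge0 ?sqr_ge0.
have cd0 : 0 <= c ^+ 2 + d ^+ 2 by rewrite addr_ge0 ?sqr_ge0.
rewrite -(@ler_pXn2r _ 2) ?nnegrE ?addr_ge0 ?sqrtr_ge0//.
rewrite sqr_sqrtr ?addr_ge0 ?sqr_ge0// sqrrD !sqr_sqrtr// -sqrtrM//.
have CS : a * c + b * d <= Num.sqrt ((a ^+ 2 + b ^+ 2) * (c ^+ 2 + d ^+ 2)).
  rewrite -[leLHS]ger0_norm ?addr_ge0 ?mulr_ge0// -sqrtr_sqr.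
  by rewrite ler_wsqrtr// -subr_ge0; have := sqr_ge0 (a * d - b * c); lra.
have : p ^+ 2 <= (a + c) ^+ 2 by rewrite ler_pXn2r ?nnegrE ?addr_ge0.
have : q ^+ 2 <= (b + d) ^+ 2 by rewrite ler_pXn2r ?nnegrE ?addr_ge0.
by rewrite mulr2n; lra.
Qed.

Lemma normcxZ l x : normcx (l *: x) = `|l| * normcx x.
Proof.
case: l x => [a b] [u v]; rewrite /normcx normc_def -rmorphM -sqrtrM /=; last first.
  by rewrite addr_ge0 ?sqr_ge0.
congr (Num.sqrt _)%:C%C.
rewrite /sqnormcx /= -!inner_norm -scaleNr !(innerDl, innerDr, innerZl, innerZr).
by rewrite (innerC v u); ring.
Qed.

Lemma normcx0_eq0 x : normcx x = 0 -> x = 0.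
Proof.
case: x => u v /complexI/eqP; rewrite sqrtr_eq0 /sqnormcx /= => le0.
have /andP[] : (`|u| ^+ 2 == 0) && (`|v| ^+ 2 == 0).
  by rewrite -paddr_eq0 ?sqr_ge0// eq_le le0 addr_ge0 ?sqr_ge0.
by rewrite !expf_eq0 /= !normr_eq0 => /eqP-> /eqP->.
Qed.

HB.instance Definition _ :=
  Lmodule_isNormed.Build R[i] HC normcxD normcxZ normcx0_eq0.

End ComplexificationTheory.

(* A possibly unbounded operator; its values outside of [dom] are irrelevant. *)
Record operator (U V : Type) := Operator { dom : set U; app :> U -> V }.

Section Operators.
Variables (K : numFieldType) (V : normedModType K).
Implicit Types (S : operator V V) (l : K).

Definition linear_operator S :=
  dom S 0 /\ forall (a : K) (x y : V), dom S x -> dom S y ->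
    dom S (a *: x + y) /\ S (a *: x + y) = a *: S x + S y.

Definition densely_defined S := dense (dom S).

Definition is_resolvent S l (Q : {linear V -> V}) :=
  [/\ continuous Q,
      forall v, dom S (Q v) /\ l *: Q v - S (Q v) = v
    & forall v, dom S v -> Q (l *: v - S v) = v].

Definition resolvent_set S : set K := [set l | exists Q, is_resolvent S l Q].

Definition spectrum S : set K := ~` resolvent_set S.

Definition is_eigenvalue S l :=
  exists v, [/\ dom S v, v != 0 & S v = l *: v].

Definition compact_operator (Q : {linear V -> V}) :=
  precompact (Q @` [set v | `|v| <= 1]).

Definition compact_resolvent S :=
  exists l Q, is_resolvent S l Q /\ compact_operator Q.

End Operators.

Definition complexify_op (V : Type) (S : operator V V) :
    operator (complexification V) (complexification V) :=
  Operator [set z | dom S (cre z) /\ dom S (cim z)]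
    (fun z => Complexification (S (cre z)) (S (cim z))).

Definition complex_mx (R : realType) (m n : nat) (A : 'M[R]_(m, n)) :
  'M[R[i]]_(m, n) := map_mx (real_complex R) A.

Definition mx_spectrum (R : realType) (n : nat) (A : 'M[R]_n) : set R[i] :=
  [set l | eigenvalue (complex_mx A) l].

Definition Hurwitz (R : realType) (n : nat) (A : 'M[R]_n) :=
  forall l : R[i], eigenvalue (complex_mx A) l -> complex.Re l < 0.

(* Euclidean inner product of R^n (the library's norm on matrices is the sup
   norm). *)
Definition dotcv (R : realType) (n : nat) (x y : 'cV[R]_n) : R :=
  \sum_i x i 0 * y i 0.

Section Semigroups.
Variables (R : realType) (V : normedModType R).
(* Only the values [T t] with [0 <= t] are relevant. *)
Implicit Types (T : R -> {linear V -> V}) (G : operator V V).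

Definition C0_semigroup T :=
  [/\ forall t, 0 <= t -> continuous (T t),
      forall x, T 0 x = x,
      forall s t, 0 <= s -> 0 <= t -> forall x, T (s + t) x = T s (T t x)
    & forall x, T t x @[t --> (0 : R)^'+] --> x].

Definition contraction_semigroup T :=
  C0_semigroup T /\ forall t x, 0 <= t -> `|T t x| <= `|x|.

Definition generates G T := forall x y,
  (dom G x /\ G x = y) <->
  (h^-1 *: (T h x - x) @[h --> (0 : R)^'+] --> y).

(* A C0-semigroup is determined by its generator, so [T] is unique. [F] is only
   applied to elements of [dom G], since [T t] preserves [dom G]. *)
Definition approx_observable (Y : lmodType R) G (F : V -> Y) :=
  exists T, [/\ C0_semigroup T, generates G T
    & forall z0, dom G z0 -> (forall t, 0 <= t -> F (T t z0) = 0) -> z0 = 0].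

End Semigroups.

Section Adjoint.
Variables (R : realType) (H : hilbertType R).
Implicit Types S : operator H H.

Definition adjoint_at S (y z : H) :=
  forall x, dom S x -> inner (S x) y = inner x z.

(* For densely defined [S], the [z] such that [adjoint_at S y z] is unique. *)
Definition adjoint S : operator H H :=
  Operator [set y | exists z, adjoint_at S y z]
    (fun y => xget 0 [set z | adjoint_at S y z]).

Definition skew_adjoint S :=
  dom (adjoint S) = dom S /\ forall x, dom S x -> adjoint S x = - S x.

End Adjoint.

Section Extrapolation.
Variables (R : realType) (H : hilbertType R) (S : operator H H).
Variables (Hm1 : completeNormedModType R) (iota : {linear H -> Hm1}).

(* [iota] exhibits [Hm1] as the completion H_{-1} of H for the norm
   w |-> |(beta - S)^-1 w|. *)
Definition is_extrapolation_space (beta : R) :=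
  exists Q, [/\ is_resolvent S beta Q,
    forall w, `|iota w| = `|Q w| & dense (range iota)].

(* The bounded extension H -> H_{-1} of [S]. *)
Definition is_extension (Sm1 : {linear H -> Hm1}) :=
  continuous Sm1 /\ forall x, dom S x -> Sm1 x = iota (S x).

(* The duality pairing between H_{-1} and D(S^* ) with pivot space H: for [w] in
   D(S^* ), the continuous extension to H_{-1} of h |-> <h, w>. *)
Definition is_duality_pairing (pairing : Hm1 -> H -> R) :=
  forall w, dom (adjoint S) w ->
    continuous (pairing^~ w) /\ forall h, pairing (iota h) w = inner h w.

(* Gammas = Gamma^* : D(S^* ) -> R^p, irrelevant outside of D(S^* ). *)
Definition is_dual_adjoint (pairing : Hm1 -> H -> R) (p : nat)
    (Gamma : 'cV[R]_p -> Hm1) (Gammas : H -> 'cV[R]_p) :=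
  forall w, dom (adjoint S) w ->
    forall u, pairing (Gamma u) w = dotcv u (Gammas w).

End Extrapolation.

Definition is_adjoint_cv (R : realType) (H : hilbertType R) (n : nat)
    (M : 'cV[R]_n -> H) (Ms : H -> 'cV[R]_n) :=
  forall x h, inner (M x) h = dotcv x (Ms h).

(* Main.v *)
Require Import Defs.
From HB Require Import structures.
From mathcomp Require Import all_boot all_order all_algebra.
From mathcomp Require Import all_classical all_reals all_analysis.
From mathcomp Require Import complex ring lra.

(* The set N of the z with B^T M^* T(t) z = 0 for all t >= 0 is a closed subspace
   invariant under Q = (1 - S)^-1. If it contains some z <> 0, compactness of Q
   and skew-adjointness of S give v <> 0 and u in N with S v = - w u and
   S u = w v: the restriction to N of the positive compact operator
   (1 - S^2)^-1 = Q^* Q has an eigenvector, N being invariant under Q^* Q because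
   the orbits of the unitary operator 2 Q - 1 that start in D(S) are recurrent.
   Then v - i u is an eigenvector of S for mu = - i w, and the Sylvester equation
   tested against v and u says that (M^* (v + i u), - Gamma^* (v + i u)),
   transposed, is a left null vector of the matrix in (viii). Hence
   Gamma^* v = Gamma^* u = 0. The semigroup of S^* = - S rotates the plane spanned
   by v and u, so v is unobservable for (S^*, Gamma^* ), which contradicts (vii). *)

Set Implicit Arguments.
Unset Strict Implicit.
Unset Printing Implicit Defensive.

Import Order.TTheory GRing.Theory Num.Theory.
Import numFieldNormedType.Exports.

Local Open Scope classical_set_scope.
Local Open Scope ring_scope.

(** * Closures and Cauchy sequences through norm estimates *)

Lemma closure_normP (R : realType) (V : normedModType R) (A : set V) (x : V) :
  closure A x <-> forall e : R, 0 < e -> exists2 y, A y & `|x - y| < e.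
Proof.
split=> [clx e e0|clx B].
  have [y [Ay xy]] := clx _ (nbhsx_ballx x e e0).
  by exists y => //; move: xy; rewrite -ball_normE.
move=> /nbhs_ballP[e /= e0 eB]; have [y Ay xy] := clx _ e0.
by exists y; split => //; apply: eB; rewrite -ball_normE.
Qed.

Lemma cauchy_seq_cvg (R : realType) (V : completeNormedModType R) (x : nat -> V) :
  (forall e : R, 0 < e -> exists N, forall n, (N <= n)%N -> `|x N - x n| < e) ->
  exists l : V, x @ \oo --> l.
Proof.
move=> xC; apply/cvg_ex/cauchy_cvgP/cauchy_exP => e e0.
have [N xN] := xC _ e0; exists (x N); exists N => // n /= Nn.
by rewrite -ball_normE; exact: xN.
Qed.

(** * Inner product geometry and projection onto closed subspaces *)

Section InnerProduct.
Variables (R : realType) (H : hilbertType R).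
Implicit Types x y z : H.

Lemma inner0l y : inner 0 y = 0 :> R.
Proof. by rewrite -(scale0r 0) innerZl mul0r. Qed.

Lemma inner0r y : inner y 0 = 0 :> R.
Proof. by rewrite innerC inner0l. Qed.

Lemma innerNl x y : inner (- x) y = - inner x y.
Proof. by rewrite -scaleN1r innerZl mulN1r. Qed.

Lemma innerNr x y : inner x (- y) = - inner x y.
Proof. by rewrite innerC innerNl innerC. Qed.

Lemma innerBl x y z : inner (x - y) z = inner x z - inner y z.
Proof. by rewrite innerDl innerNl. Qed.

Lemma innerBr x y z : inner x (y - z) = inner x y - inner x z.
Proof. by rewrite innerDr innerNr. Qed.

Lemma sqr_normD x y : `|x + y| ^+ 2 = `|x| ^+ 2 + 2 * inner x y + `|y| ^+ 2.
Proof.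
by rewrite -!inner_norm innerDl !innerDr (innerC y x); ring.
Qed.

Lemma sqr_normB x y : `|x - y| ^+ 2 = `|x| ^+ 2 - 2 * inner x y + `|y| ^+ 2.
Proof. by rewrite sqr_normD innerNr normrN mulrN. Qed.

Lemma inner_eq0 x : inner x x = 0 -> x = 0.
Proof. by move/eqP; rewrite inner_norm expf_eq0 /= normr_eq0 => /eqP. Qed.

(** Expanding the nonnegative square norm of |y|^2 x - <x, y> y gives the squared inequality, up to
    the factor |y|^2. *)
Lemma cauchy_schwarz x y : `|inner x y| <= `|x| * `|y|.
Proof.
have [->|y0] := eqVneq y 0; first by rewrite inner0r !normr0 mulr0.
rewrite -(@ler_pXn2r _ 2) ?nnegrE ?mulr_ge0// real_normK ?num_real// exprMn.
have y20 : 0 < `|y| ^+ 2 by rewrite exprn_gt0// normr_gt0.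
have := sqr_ge0 (`|(`|y| ^+ 2) *: x - inner x y *: y| : R).
rewrite sqr_normB !normrZ !exprMn innerZl innerZr !real_normK ?num_real//.
set a := `|y| ^+ 2; set b := `|x| ^+ 2; set c := inner x y => h.
have {}h : 0 <= a * (b * a - c ^+ 2) by rewrite /a /b /c in h *; lra.
by move: h; rewrite pmulr_rge0// subr_ge0.
Qed.

Lemma continuous_innerl y : continuous (fun x => inner x y : R).
Proof.
move=> x; apply/cvgrPdist_le => e e0.
have y1 : 0 < `|y| + 1 by rewrite ltr_wpDl.
near=> z; rewrite -innerBl (le_trans (cauchy_schwarz _ _))//.
have : `|x - z| < e / (`|y| + 1).
  by near: z; apply: cvgr_dist_lt; rewrite ?divr_gt0.
rewrite ltr_pdivlMr// => /ltW; apply: le_trans.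
by rewrite ler_wpM2l// lerDl.
Unshelve. all: by end_near. Qed.

Lemma continuous_innerr y : continuous (fun x => inner y x : R).
Proof.
by under [X in continuous X]eq_fun do rewrite innerC; exact: continuous_innerl.
Qed.

Variable V : set H.
Hypotheses (V0 : V 0) (Vlin : forall (a : R) x y, V x -> V y -> V (a *: x + y)).
Hypothesis Vcl : closure V `<=` V.

(** A minimising sequence for the distance [d] from [y] to [V] is Cauchy by the parallelogram
    identity; perturbing its limit [r] along [v] gives orthogonality. *)
Lemma orthogonal_projection y :
  exists2 r, V r & forall v, V v -> inner (y - r) v = 0.
Proof.
pose D := [set `|y - v| | v in V]; pose d := inf D.
have Dlb : has_lbound D by exists 0 => _ [v _ <-].
have Dinf : has_inf D by split => //; exists `|y - 0|; exists 0.
have dV v : V v -> d <= `|y - v| by move=> Vv; apply: ge_inf => //; exists v.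
have d0 : 0 <= d by apply: lb_le_inf; [case: Dinf|move=> _ [v _ <-]].
have /choice[u uP] n : exists v, V v /\ `|y - v| < d + n.+1%:R^-1.
  have n0 : 0 < n.+1%:R^-1 :> R by rewrite invr_gt0.
  by have [_ [v Vv <-]] := inf_adherent n0 Dinf; exists v.
(* The midpoint of [v] and [w] lies in [V], hence at distance at least [d] from [y]; the
   parallelogram identity then bounds |v - w|^2 by 4 (d + t)^2 - 4 d^2. *)
have midpoint v w (t : R) : V v -> V w -> `|y - v| <= d + t ->
    `|y - w| <= d + t -> `|v - w| ^+ 2 <= 4 * t * (2 * d + t).
  move=> Vv Vw yv yw.
  have dm : d <= `|y - 2^-1 *: (v + w)|.
    apply: dV; rewrite -[_ *: _]addr0; apply: Vlin => //.
    by rewrite -[v]scale1r; exact: Vlin.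
  have E1 : y - 2^-1 *: (v + w) = 2^-1 *: ((y - v) + (y - w)).
    rewrite addrACA -opprD scalerBr (scalerDr _ y y) -scalerDl.
    have -> : 2^-1 + 2^-1 = 1 :> R by field.
    by rewrite scale1r.
  have E2 : v - w = (y - w) - (y - v) by rewrite opprB [RHS]addrC addrA subrK.
  have d2 : d ^+ 2 <= `|y - 2^-1 *: (v + w)| ^+ 2 by rewrite ler_pXn2r ?nnegrE.
  have h1 : `|y - v| ^+ 2 <= (d + t) ^+ 2.
    by rewrite ler_pXn2r ?nnegrE// (le_trans _ yv).
  have h2 : `|y - w| ^+ 2 <= (d + t) ^+ 2.
    by rewrite ler_pXn2r ?nnegrE// (le_trans _ yw).
  move: d2; rewrite E1 E2 normrZ exprMn (ger0_norm (_ : 0 <= 2^-1))//.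
  rewrite (sqr_normD (y - v)) (sqr_normB (y - w)) (innerC (y - w)).
  by move: (inner _ _ : R) (`|y - v| ^+ 2) (`|y - w| ^+ 2) h1 h2 => a b c; lra.
have [r ur] : exists r : H, u @ \oo --> r.
  apply: cauchy_seq_cvg => e e0.
  (* As t <= 1, this choice gives 4 t (2 d + t) < 8 (d + 1) t <= e^2. *)
  pose t := Num.min 1 (e ^+ 2 / (8 * (d + 1))).
  have d1 : 0 < d + 1 by rewrite ltr_wpDl.
  have t0 : 0 < t by rewrite lt_min ltr01 divr_gt0 ?exprn_gt0 ?mulr_gt0.
  have t1 : t <= 1 by rewrite ge_min lexx.
  have te : t * (8 * (d + 1)) <= e ^+ 2.
    by rewrite -ler_pdivlMr ?mulr_gt0// ge_min lexx orbT.
  have [N _ NP] := near_infty_natSinv_lt (PosNum t0).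
  exists N => n Nn.
  have uN k : (N <= k)%N -> V (u k) /\ `|y - u k| <= d + t.
    move=> Nk; have [Vk yk] := uP k; split => //.
    by apply/ltW/(lt_le_trans yk); rewrite lerD2l; apply/ltW/NP.
  have [VN yN] := uN _ (leqnn N); have [Vn yn] := uN _ Nn.
  rewrite -(@ltr_pXn2r _ 2) ?nnegrE ?(ltW e0)//.
  apply: (le_lt_trans (midpoint _ _ _ VN Vn yN yn)).
  apply: lt_le_trans te; rewrite [ltRHS]mulrC -subr_gt0.
  have -> : 8 * (d + 1) * t - 4 * t * (2 * d + t) = t * (8 - 4 * t) by ring.
  by rewrite mulr_gt0//; lra.
have Vr : V r.
  apply: Vcl; apply/closure_normP => e e0.
  have [N _ NP] := (iffLR (cvgrPdist_lt _ _)) ur e e0.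
  by exists (u N); [case: (uP N)|exact: (NP N (leqnn N))].
have yr : `|y - r| <= d.
  apply/ler_addgt0Pr => e e0.
  have e20 : 0 < e / 2 by rewrite divr_gt0.
  have [N _ NP] := (iffLR (cvgrPdist_lt _ _)) ur _ e20.
  have [N' _ N'P] := near_infty_natSinv_lt (PosNum e20).
  pose k := maxn N N'.
  have rk := NP k (leq_maxl _ _); have kk := N'P k (leq_maxr _ _).
  have [_ yk] := uP k.
  have -> : y - r = (y - u k) - (r - u k) by rewrite opprB addrA subrK.
  apply: (le_trans (ler_normB _ _)); move: rk kk yk => /=.
  by move: (k.+1%:R^-1 : R) (`|r - u k| : R) (`|y - u k| : R) => a b c; lra.
exists r => // v Vv.
(* The competitor is r + c / (k + 1) v; the denominator k + 1 stays positive even for v = 0, and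
   minimality leaves - (c / (k + 1))^2 (k + 2) >= 0. *)
set c := inner _ _; set k := `|v| ^+ 2.
have k0 : 0 <= k by rewrite sqr_ge0.
have : d ^+ 2 <= `|y - ((c / (k + 1)) *: v + r)| ^+ 2.
  by rewrite ler_pXn2r ?nnegrE//; apply: dV; exact: Vlin.
rewrite opprD addrCA addrC sqr_normB innerZr normrZ exprMn real_normK ?num_real//.
rewrite -/c -/k => h.
have yr2 : `|y - r| ^+ 2 <= d ^+ 2 by rewrite ler_pXn2r ?nnegrE.
have k1 : 0 < k + 1 by rewrite ltr_wpDl.
have {}h : 0 <= (c / (k + 1)) ^+ 2 * k - 2 * (c / (k + 1) * c) by lra.
have E : (c / (k + 1)) ^+ 2 * k - 2 * (c / (k + 1) * c)
    = - (c / (k + 1)) ^+ 2 * (k + 2).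
  by field; rewrite gt_eqF.
move: h; rewrite E mulNr oppr_ge0 pmulr_lle0; last by rewrite ltr_wpDl.
move=> h; have : (c / (k + 1)) ^+ 2 = 0 by apply/eqP; rewrite eq_le h sqr_ge0.
by move/eqP; rewrite expf_eq0 /= mulf_eq0 invr_eq0 (gt_eqF k1) orbF => /eqP.
Qed.

End InnerProduct.

(** * Unbounded linear operators and their resolvents *)

Lemma subrACA (V : zmodType) (x y z t : V) : x - y - (z - t) = x - z - (y - t).
Proof. by rewrite !opprD !opprK addrACA. Qed.

Lemma dense_normP (R : realType) (V : normedModType R) (D : set V) (x : V) (e : R) :
  dense D -> 0 < e -> exists2 y, D y & `|x - y| < e.
Proof.
move=> dD e0; have [||y [xy Dy]] := dD (ball x e).
- by exists x; exact: ballxx.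
- exact: ball_open.
by exists y => //; move: xy; rewrite -ball_normE.
Qed.

Section LinearOperators.
Variables (R : realType) (V : normedModType R) (S : operator V V).
Hypothesis Slin : linear_operator S.

Lemma domZ (a : R) x : dom S x -> dom S (a *: x).
Proof.
case: Slin => S0 SD Dx; rewrite -[_ *: _]addr0.
by have [] := SD a x 0 Dx S0.
Qed.

Lemma domD x y : dom S x -> dom S y -> dom S (x + y).
Proof.
case: Slin => S0 SD Dx Dy; rewrite -[x]scale1r.
by have [] := SD 1 x y Dx Dy.
Qed.

Lemma domB x y : dom S x -> dom S y -> dom S (x - y).
Proof. by move=> Dx Dy; rewrite -scaleN1r; apply: domD => //; exact: domZ. Qed.

Lemma operatorD x y : dom S x -> dom S y -> S (x + y) = S x + S y.
Proof.
case: Slin => S0 SD Dx Dy.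
by have [_] := SD 1 x y Dx Dy; rewrite !scale1r.
Qed.

Lemma operatorZ (a : R) x : dom S x -> S (a *: x) = a *: S x.
Proof.
case: Slin => S0 SD Dx; have := operatorD S0 S0.
rewrite addr0 => /eqP; rewrite -subr_eq0 opprD addNKr oppr_eq0 => /eqP S00.
by have [_] := SD a x 0 Dx S0; rewrite S00 !addr0.
Qed.

Lemma operatorB x y : dom S x -> dom S y -> S (x - y) = S x - S y.
Proof.
move=> Dx Dy; rewrite -scaleN1r operatorD//; last exact: domZ.
by rewrite operatorZ// scaleN1r.
Qed.

Lemma resolvent_op (b : R) (Q : {linear V -> V}) v :
  is_resolvent S b Q -> dom S (Q v) /\ S (Q v) = b *: Q v - v.
Proof.
by case=> _ QP _; have [DQ E] := QP v; split => //; rewrite -[X in _ - X]E subKr.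
Qed.

(** Apply [P] to (a - S) Q v = v + (a - b) Q v. This form transfers compactness between resolvents
    and inverts the Cayley transform. *)
Lemma resolvent_identity (a b : R) (P Q : {linear V -> V}) v :
  is_resolvent S a P -> is_resolvent S b Q ->
  Q v = P (v + (a - b) *: Q v).
Proof.
move=> [_ _ PK] rQ; have [DQ SQ] := resolvent_op v rQ.
rewrite -[LHS]PK// SQ; congr (P _); rewrite scalerBl opprB.
by rewrite addrCA addrA.
Qed.

End LinearOperators.

(** * Existence of the resolvents of a skew-adjoint operator *)

Section SkewAdjoint.
Variables (R : realType) (H : hilbertType R) (S : operator H H).
Hypotheses (Slin : linear_operator S) (Sdense : densely_defined S).

Lemma dense_orth0 (D : set H) (x : H) :
  dense D -> (forall y, D y -> inner y x = 0 :> R) -> x = 0.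
Proof.
move=> dD Dx; have [//|] := eqVneq x 0; rewrite -normr_gt0 => x0.
have [y Dy xy] := dense_normP x dD x0.
have : `|x| ^+ 2 = inner (x - y) x by rewrite innerBl (Dx y Dy) subr0 inner_norm.
have := le_trans (ler_norm _) (cauchy_schwarz (x - y) x).
move=> + E; rewrite -E expr2 ler_pM2r// => h.
by move: (lt_le_trans xy h); rewrite ltxx.
Qed.

Hypothesis Sskew : skew_adjoint S.

(** The value of [adjoint S] is picked by [xget], so it satisfies the adjoint relation once some
    vector does. *)
Lemma skew_adjoint_at x : dom S x -> adjoint_at S x (- S x).
Proof.
case: Sskew => domE adjE Dx; rewrite -adjE//.
have : dom (adjoint S) x by rewrite domE.
by case=> z xz; apply: (@xgetPex _ 0 [set z | adjoint_at S x z]); exists z.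
Qed.

Lemma skew_inner x y : dom S x -> dom S y -> inner (S x) y = - inner x (S y) :> R.
Proof. by move=> Dx Dy; rewrite (skew_adjoint_at Dy)// innerNr. Qed.

Lemma skew_inner0 x : dom S x -> inner (S x) x = 0 :> R.
Proof.
by move=> Dx; have := skew_inner Dx Dx; rewrite [inner x _]innerC; lra.
Qed.

(** Domain membership comes from the equality of the domains of [S] and its adjoint, the value from
    density. Limits and orthogonal vectors are placed in [dom S] this way. *)
Lemma skew_adjointP x z : adjoint_at S x z -> dom S x /\ S x = - z.
Proof.
move=> xz; have Dx : dom S x by case: Sskew => <- _; exists z.
split => //; apply/eqP; rewrite -subr_eq0 opprK; apply/eqP.
apply: (dense_orth0 Sdense) => y Dy.
by rewrite innerDr -(xz y Dy) (skew_inner Dy Dx) addrN.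
Qed.

Lemma sqr_norm_skew (b : R) x : dom S x ->
  `|b *: x - S x| ^+ 2 = b ^+ 2 * `|x| ^+ 2 + `|S x| ^+ 2.
Proof.
move=> Dx; rewrite sqr_normB innerZl innerC (skew_inner0 Dx) !mulr0 subr0.
by rewrite normrZ exprMn real_normK ?num_real.
Qed.

Lemma norm_skew_ge (b : R) x : dom S x -> `|b| * `|x| <= `|b *: x - S x|.
Proof.
move=> Dx; rewrite -(@ler_pXn2r _ 2) ?nnegrE ?mulr_ge0//.
by rewrite sqr_norm_skew// exprMn real_normK ?num_real// lerDl sqr_ge0.
Qed.

(** By [norm_skew_ge], preimages of a convergent sequence are Cauchy; their limit is in [dom S]
    because the adjoint relation passes to limits. *)
Lemma closed_range_skew (b : R) : b != 0 ->
  closure [set b *: x - S x | x in dom S] `<=` [set b *: x - S x | x in dom S].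
Proof.
move=> b0 y /closure_normP cly.
have b0' : 0 < `|b| by rewrite normr_gt0.
have /choice[x xP] n : exists x, dom S x /\ `|y - (b *: x - S x)| < n.+1%:R^-1.
  have [|_ [x Dx <-] yx] := cly n.+1%:R^-1; first by rewrite invr_gt0.
  by exists x.
pose v n := b *: x n - S (x n).
have vy : v @ \oo --> y.
  apply/cvgrPdist_lt => e e0.
  have [N _ NP] := near_infty_natSinv_lt (PosNum e0).
  exists N => // n /= Nn; have [_ yn] := xP n.
  by apply: (lt_trans yn); exact: NP.
have [l xl] : exists l : H, x @ \oo --> l.
  apply: cauchy_seq_cvg => e e0.
  have e20 : 0 < `|b| * e / 2 by rewrite divr_gt0// mulr_gt0.
  have [N _ NP] := (iffLR (cvgrPdist_lt _ _)) vy _ e20.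
  exists N => n Nn; rewrite -(ltr_pM2l b0').
  have [[DN _] [Dn _]] := (xP N, xP n).
  apply: (le_lt_trans (norm_skew_ge _ (domB Slin DN Dn))).
  have -> : b *: (x N - x n) - S (x N - x n) = (y - v n) - (y - v N).
    by rewrite operatorB// scalerBr subrACA (opprB y) [RHS]addrC subrKA.
  apply: (le_lt_trans (ler_normB _ _)); rewrite [ltRHS]splitr.
  by rewrite ltrD//; apply: NP => /=.
(* Limit of <S w, x_n> = <w, v_n - b x_n>, which holds since - S x_n = v_n - b x_n. *)
have : adjoint_at S l (y - b *: l).
  move=> w Dw; apply: (@norm_cvg_unique _ _ ((fun n => inner (S w) (x n) : R) @ \oo)).
  - exact: (cvg_comp _ _ xl (@continuous_innerr _ _ (S w) l)).
  - have -> : (fun n => inner (S w) (x n) : R) =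
        (fun n => inner w (v n - b *: x n)).
      apply/funext => n; have [Dn _] := xP n.
      by rewrite (skew_inner Dw Dn) /v addrAC subrr sub0r innerNr.
    have vbx : (fun n => v n - b *: x n) @ \oo --> y - b *: l.
      by apply: cvgB => //; apply: cvgZr.
    exact: (cvg_comp _ _ vbx (@continuous_innerr _ _ w _)).
move=> /skew_adjointP[Dl Sl]; exists l => //.
by rewrite Sl opprK addrC subrK.
Qed.

(* A vector w orthogonal to the range of b - S lies in D(S^* ) with S^* w = b w,
   hence b |w|^2 = - <S w, w> = 0. *)
Lemma skew_resolvent (b : R) : b != 0 ->
  exists Q : {linear H -> H}, is_resolvent S b Q.
Proof.
move=> b0; have b0' : 0 < `|b| by rewrite normr_gt0.
have inj x : dom S x -> b *: x - S x = 0 -> x = 0.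
  move=> Dx E; have := norm_skew_ge b Dx; rewrite E normr0 pmulr_rle0//.
  by rewrite normr_le0 => /eqP.
have /choice[q qP] y : exists x, dom S x /\ b *: x - S x = y.
  have [|||r [x Dx <-] yr] := @orthogonal_projection _ _
      [set b *: x - S x | x in dom S] _ _ _ y.
  - exists 0; first by case: Slin.
    by rewrite -[in S 0](scale0r 0) operatorZ ?scale0r ?scaler0 ?subr0//; case: Slin.
  - move=> a _ _ [x Dx <-] [z Dz <-].
    exists (a *: x + z); first by apply: domD => //; exact: domZ.
    rewrite operatorD// ?operatorZ//; last exact: domZ.
    by rewrite scalerDr scalerBr !scalerA mulrC opprD addrACA.
  - exact: closed_range_skew.
  exists x; split => //; apply/esym/eqP; rewrite -subr_eq0; apply/eqP.
  set w := y - _ in yr *.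
  have : adjoint_at S w (b *: w).
    move=> z Dz; have : inner w (b *: z - S z) = 0 :> R by apply: yr; exists z.
    by rewrite innerBr !innerZr (innerC w) (innerC w) => /subr0_eq.
  move=> /skew_adjointP[Dw Sw]; have := skew_inner0 Dw.
  rewrite Sw innerNl innerZl => /eqP.
  by rewrite oppr_eq0 mulf_eq0 (negbTE b0) => /eqP/inner_eq0.
have qK x : dom S x -> q (b *: x - S x) = x.
  move=> Dx; have [Dq E] := qP (b *: x - S x).
  apply/eqP; rewrite -subr_eq0; apply/eqP/inj; first exact: domB.
  by rewrite operatorB// scalerBr subrACA E subrr.
have qlin : linear q.
  move=> a x y; have [[Dx Ex] [Dy Ey]] := (qP x, qP y).
  have Dz : dom S (a *: q x) by exact: domZ.
  rewrite -[RHS]qK; last exact: domD.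
  congr q; rewrite operatorD// operatorZ// -{1}Ex -{1}Ey.
  by rewrite !scalerDr scalerN !scalerA mulrC opprD addrACA.
pose Q : {linear H -> H} := HB.pack q (GRing.isLinear.Build _ _ _ _ q qlin).
exists Q; split => //.
apply: bounded_linear_continuous; apply/linear_boundedP.
exists `|b|^-1; split; first exact: num_real.
move=> r br x; have [Dx {2}<-] := qP x.
apply: (@le_trans _ _ (`|b|^-1 * `|b *: q x - S (q x)|)).
  by rewrite ler_pdivlMl//; exact: norm_skew_ge.
by rewrite ler_wpM2r// ltW.
Qed.

End SkewAdjoint.

(** The point [p] is a cluster point of the images; stating it this way avoids extracting a
    subsequence. *)
Definition seq_compact (R : realType) (V : normedModType R) (Q : V -> V) :=
  forall (x : nat -> V) (c : R), (forall k, `|x k| <= c) ->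
  exists p, forall e : R, 0 < e -> forall n, exists2 k, (n <= k)%N & `|p - Q (x k)| < e.

Lemma compact_operator_seq (R : realType) (V : normedModType R) (Q : {linear V -> V}) :
  compact_operator Q -> seq_compact Q.
Proof.
move=> [A QA [Aco _]] x c xc.
(* Dividing by [d], positive even when [c] is 0, brings the sequence into the unit ball. *)
pose d := `|c| + 1; have d0 : 0 < d by rewrite ltr_wpDl.
pose F := (fun k => Q (d^-1 *: x k)) @ \oo.
have FA : F A.
  exists 0%N => // k _ /=; apply: QA; exists (d^-1 *: x k) => //=.
  rewrite normrZ ger0_norm ?invr_ge0 ?(ltW d0)// ler_pdivrMl// mulr1.
  apply: (le_trans (xc k)); apply: (le_trans (ler_norm c)).
  by rewrite lerDl.
have [p [_ pF]] := Aco F _ FA.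
exists (d *: p) => e e0 n.
have [|_ [[k /= nk <-]]] := pF [set Q (d^-1 *: x k) | k in [set k | (n <= k)%N]]
    (ball p (e / d)) _ (nbhsx_ballx _ _ (divr_gt0 e0 d0)).
  by exists n => // k /= nk; exists k.
rewrite -ball_normE /= => pk; exists k => //.
have -> : Q (x k) = d *: Q (d^-1 *: x k).
  by rewrite linearZ scalerA divff ?scale1r// gt_eqF.
by rewrite -scalerBr normrZ gtr0_norm// mulrC -ltr_pdivlMr.
Qed.

(** * Cayley transform and spectral analysis on an invariant subspace *)

Section SkewResolvents.
Variables (R : realType) (H : hilbertType R) (S : operator H H).
Hypotheses (Slin : linear_operator S) (Sdense : densely_defined S).
Hypothesis Sskew : skew_adjoint S.
Variables Q P : {linear H -> H}.
Hypotheses (rQ : is_resolvent S 1 Q) (rP : is_resolvent S (-1) P).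

Let DQ v : dom S (Q v). Proof. by case: (resolvent_op v rQ). Qed.
Let DP v : dom S (P v). Proof. by case: (resolvent_op v rP). Qed.
Let SQ v : S (Q v) = Q v - v.
Proof. by case: (resolvent_op v rQ) => _ ->; rewrite scale1r. Qed.
Let SP v : S (P v) = - P v - v.
Proof. by case: (resolvent_op v rP) => _ ->; rewrite scaleN1r. Qed.

Lemma norm_skew_resolvent (b : R) (L : {linear H -> H}) v :
  `|b| = 1 -> is_resolvent S b L -> `|L v| <= `|v|.
Proof.
move=> b1 [_ LP _]; have [DL E] := LP v.
by have := norm_skew_ge Sskew b DL; rewrite b1 mul1r E.
Qed.

(** The adjoint of (1 - S)^-1 is (1 + S)^-1, which is [- P] because [P] is the resolvent at -1. *)
Lemma skew_resolvent_adj x y : inner (Q x) y = - inner x (P y) :> R.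
Proof.
have {1}-> : y = - P y - S (P y) by rewrite SP opprB addrC subrK.
rewrite innerBr innerNr -(opprK (inner (Q x) (S (P y)))).
rewrite -(skew_inner Sskew (DQ x) (DP y)) SQ innerBl; ring.
Qed.

(** The resolvent identity writes Q x as [L] applied to x + (l - 1) Q x, which stays bounded when x
    does. *)
Lemma resolvent_seq_compact (l : R) (L : {linear H -> H}) :
  is_resolvent S l L -> compact_operator L -> seq_compact Q.
Proof.
move=> rL /compact_operator_seq Lc x c xc.
have [|p pP] := Lc (fun k => x k + (l - 1) *: Q (x k)) (c + `|l - 1| * c).
  move=> k; rewrite (le_trans (ler_normD _ _))// lerD// normrZ ler_wpM2l//.
  by apply: le_trans (xc k); apply: norm_skew_resolvent rQ; rewrite normr1.
exists p => e e0 n; have [k nk pk] := pP e e0 n; exists k => //.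
by rewrite (resolvent_identity _ rL rQ).
Qed.

(* The Cayley transform (1 + S) (1 - S)^-1. *)
Definition cayley x := 2 *: Q x - x.

Lemma cayleyB x y : cayley (x - y) = cayley x - cayley y.
Proof. by rewrite /cayley linearB scalerBr subrACA. Qed.

(** Since <S (Q x), Q x> = 0, one has <Q x, x> = |Q x|^2, and the terms 4 |Q x|^2 and - 4 <Q x, x>
    cancel. *)
Lemma norm_cayley x : `|cayley x| = `|x|.
Proof.
apply/eqP; rewrite -(@eqrXn2 _ 2)//; apply/eqP.
have Qx : inner (Q x) x = `|Q x| ^+ 2 :> R.
  have {2}-> : x = Q x - S (Q x) by rewrite SQ subKr.
  by rewrite innerBr inner_norm innerC (skew_inner0 Sskew (DQ x)) subr0.
rewrite /cayley sqr_normB normrZ innerZl Qx exprMn ger0_norm//; ring.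
Qed.

(** This is (1 - S) (1 + S)^-1 = 2 (1 + S)^-1 - 1, with (1 + S)^-1 = - P. *)
Definition cayley_inv x := - (2 *: P x) - x.

Lemma cayleyK x : cayley (cayley_inv x) = x.
Proof.
have := resolvent_identity x rQ rP.
rewrite -[1 - -1]/(1 - (- 1)) opprK => E.
have QV : Q (cayley_inv x) = - P x.
  by rewrite E -linearN; congr (Q _); rewrite /cayley_inv opprD addrC.
by rewrite /cayley QV /cayley_inv scalerN opprB opprK addrC addrK.
Qed.

Lemma iter_cayleyB k x y :
  iter k cayley (x - y) = iter k cayley x - iter k cayley y.
Proof. by elim: k => //= k ->; rewrite cayleyB. Qed.

Lemma norm_iter_cayley k x : `|iter k cayley x| = `|x|.
Proof. by elim: k => //= k <-; rewrite norm_cayley. Qed.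

Lemma iter_cayley_resolvent k x : iter k cayley (Q x) = Q (iter k cayley x).
Proof.
by elim: k => //= k ->; rewrite /cayley linearB linearZ.
Qed.

Hypothesis Qcompact : seq_compact Q.

(* U^k (Q y) = Q (U^k y) stays in a compact set, so U^j (Q y) and U^k (Q y) are
   close for some j > k, and U is an isometry. *)
Lemma cayley_recurrent y (e : R) : 0 < e ->
  exists m, `|iter m.+1 cayley (Q y) - Q y| < e.
Proof.
move=> e0; have e20 : 0 < e / 2 by rewrite divr_gt0.
have [|p pP] := Qcompact (x := fun k => iter k cayley y) (c := `|y|).
  by move=> k; rewrite norm_iter_cayley.
(* Searching [j] from [k.+1] on guarantees at least one iteration between the two close iterates. *)
have [k _ pk] := pP _ e20 0%N; have [j kj pj] := pP _ e20 k.+1.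
exists (j - k.+1)%N; rewrite -(norm_iter_cayley k) iter_cayleyB -iterD.
have -> : (k + (j - k.+1).+1 = j)%N by rewrite -addSnnS subnKC.
rewrite !iter_cayley_resolvent -(subrKA p) addrC -(opprB p).
by rewrite (le_lt_trans (ler_normB _ _))// [ltRHS]splitr ltrD.
Qed.

Variable N : set H.
Hypotheses (Ncl : closure N `<=` N)
  (Nlin : forall (a : R) x y, N x -> N y -> N (a *: x + y)) (N0 : N 0)
  (QN : forall x, N x -> N (Q x)).

Let NZ (a : R) x : N x -> N (a *: x).
Proof. by move=> Nx; rewrite -[_ *: _]addr0; apply: Nlin. Qed.
Let NB x y : N x -> N y -> N (x - y).
Proof. by move=> Nx Ny; rewrite -scaleN1r addrC; apply: Nlin. Qed.

(* By recurrence U^-1 x is a limit of forward iterates U^m x, which stay in N. *)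
Lemma resolvent_opp_invariant y : N (Q y) -> N (P (Q y)).
Proof.
move=> Nx; have NV : N (cayley_inv (Q y)).
  apply: Ncl; apply/closure_normP => e e0; have [m xm] := cayley_recurrent y e0.
  (* The isometry U maps U^-1 (Q y) - U^m (Q y) to Q y - U^(m+1) (Q y), which is small by
     recurrence. *)
  exists (iter m cayley (Q y)).
    by elim: m {xm} => //= m IH; apply: NB => //; apply: NZ; exact: QN.
  by rewrite -norm_cayley cayleyB cayleyK distrC.
have -> : P (Q y) = (- 2^-1) *: (cayley_inv (Q y) - (- 1) *: Q y).
  rewrite /cayley_inv scaleN1r opprK subrK scalerN scaleNr opprK scalerA.
  by rewrite mulVf ?scale1r// pnatr_eq0.
by apply: NZ; apply: NB => //; apply: NZ.
Qed.

(* K = - P Q = Q^* Q is positive, so a maximising sequence of |Q v|^2 = <K v, v>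
   on the unit ball of N is an approximate eigenvector of K. *)
Lemma skew_eigenvector z : N z -> z != 0 ->
  exists v (k : R), [/\ N v, v != 0, 0 < k & P (Q v) = - k *: v].
Proof.
move=> Nz z0; pose K v := - P (Q v).
have NK v : N v -> N (K v).
  move=> Nv; rewrite /K -scaleN1r; apply: NZ; apply: resolvent_opp_invariant.
  exact: QN.
have KB v w : K (v - w) = K v - K w.
  by rewrite /K (linearB Q) (linearB P) opprB opprK [RHS]addrC.
have normQ v : `|Q v| <= `|v| by apply: norm_skew_resolvent rQ; rewrite normr1.
have normP v : `|P v| <= `|v| by apply: norm_skew_resolvent rP; rewrite normrN1.
have normK v : `|K v| <= `|v| by rewrite normrN (le_trans (normP _)).
have innerK v w : inner (K v) w = inner (Q v) (Q w) :> R.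
  by rewrite innerNl (innerC (Q v)) skew_resolvent_adj innerC.
pose E := [set `|Q v| ^+ 2 | v in [set v | N v /\ `|v| <= 1]].
pose k := sup E.
have Esup : has_sup E.
  split; first by exists (`|Q 0| ^+ 2); exists 0; rewrite //= normr0 ler01.
  exists 1 => _ [v [_ v1] <-]; rewrite expr_le1// ?normr_ge0//.
  exact: le_trans (normQ v) v1.
have Qk v : N v -> `|Q v| ^+ 2 <= k * `|v| ^+ 2.
  move=> Nv; have [->|v0] := eqVneq v 0.
    by rewrite linear0 normr0 expr0n mulr0.
  have nv0 : 0 < `|v| by rewrite normr_gt0.
  rewrite -ler_pdivrMr ?exprn_gt0//; apply: sup_upper_bound => //.
  exists (`|v|^-1 *: v).
    split; first exact: NZ.
    by rewrite normrZ normfV normr_id mulVf ?lexx// gt_eqF.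
  by rewrite linearZ normrZ normfV normr_id exprMn exprVn mulrC.
have Qinj v : Q v = 0 -> v = 0.
  move=> Qv; have := SQ v; rewrite Qv sub0r.
  have := operatorZ Slin 0 (DQ v); rewrite Qv scaler0 scale0r => ->.
  by move=> /eqP; rewrite eq_sym oppr_eq0 => /eqP.
have k0 : 0 < k.
  have nz0 : 0 < `|z| by rewrite normr_gt0.
  have nQ0 : 0 < `|Q z| by rewrite normr_gt0; apply: contra_neq z0; exact: Qinj.
  have := lt_le_trans (exprn_gt0 2 nQ0) (Qk z Nz).
  by rewrite pmulr_lgt0// exprn_gt0.
(* Cauchy-Schwarz on |K v|^2 = <Q v, Q (K v)>, then [Qk] at K v, gives |K v|^4 <= |Q v|^2 k |K
   v|^2. *)
have Kk v : N v -> `|K v| ^+ 2 <= k * `|Q v| ^+ 2.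
  move=> Nv; have [->|Kv0] := eqVneq (K v) 0.
    by rewrite normr0 expr0n mulr_ge0 ?sqr_ge0// ltW.
  have nK0 : 0 < `|K v| ^+ 2 by rewrite exprn_gt0// normr_gt0.
  rewrite -(ler_pM2r nK0) -expr2.
  have KvE : `|K v| ^+ 2 = inner (Q v) (Q (K v)) :> R.
    by rewrite -inner_norm innerK.
  rewrite [in leLHS]KvE.
  rewrite -[leLHS]real_normK ?num_real//.
  have : `|inner (Q v) (Q (K v))| ^+ 2 <= (`|Q v| * `|Q (K v)|) ^+ 2 :> R.
    by rewrite ler_pXn2r ?nnegrE ?mulr_ge0//; exact: cauchy_schwarz.
  move=> /le_trans; apply; rewrite exprMn.
  rewrite (mulrAC k) [leRHS]mulrC ler_wpM2l ?sqr_ge0//.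
  exact: Qk (NK _ Nv).
(* Expanding the square, the left side is at most k |Q v|^2 - 2 k |Q v|^2 + k^2. *)
have almost v : N v -> `|v| <= 1 ->
    `|K v - k *: v| ^+ 2 <= k * (k - `|Q v| ^+ 2).
  move=> Nv v1; have := Kk v Nv.
  rewrite sqr_normB innerZr innerK inner_norm normrZ exprMn gtr0_norm//.
  have : k ^+ 2 * `|v| ^+ 2 <= k ^+ 2 * 1.
    by rewrite ler_wpM2l ?sqr_ge0// expr_le1.
  by move: (`|K v| ^+ 2) (`|Q v| ^+ 2) (k ^+ 2 * `|v| ^+ 2) => a b c; lra.
have /choice[v vP] n : exists v, [/\ N v, `|v| <= 1 & k - n.+1%:R^-1 < `|Q v| ^+ 2].
  have n0 : 0 < n.+1%:R^-1 :> R by rewrite invr_gt0.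
  have [_ [v [Nv v1] <-] kv] := sup_adherent n0 Esup.
  by exists v.
have [|q qP] := Qcompact (x := v) (c := 1); first by move=> n; case: (vP n).
(* As K = - P Q with [P] a contraction, [p] is a cluster point of the K v_n. *)
pose p := - P q.
have approx (e : R) : 0 < e -> exists v, [/\ N v, `|v| <= 1,
    `|K v - k *: v| < e, `|p - K v| < e & k - e < `|Q v| ^+ 2].
  (* The bound e^2 / k turns the estimate of [almost] into |K v - k v|^2 < e^2. *)
  move=> e0; pose d := Num.min e (e ^+ 2 / k).
  have d0 : 0 < d by rewrite lt_min e0 divr_gt0// exprn_gt0.
  have [M _ MP] := near_infty_natSinv_lt (PosNum d0).
  have [n Mn qn] := qP e e0 M; have [Nv v1 kv] := vP n.
  have := MP n Mn; rewrite /= lt_min => /andP[ne nek].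
  exists (v n); split => //.
  - rewrite -(@ltr_pXn2r _ 2) ?nnegrE// ?(ltW e0)//.
    apply: (le_lt_trans (almost _ Nv v1)); rewrite mulrC -ltr_pdivlMr//.
    by apply: lt_trans nek; rewrite ltrBlDr addrC -ltrBlDr.
  - rewrite /p /K -opprD normrN -linearB.
    exact: le_lt_trans (normP _) qn.
  - by apply: lt_trans kv; rewrite ltrD2l ltrN2.
have pv (e : R) w : `|K w - k *: w| < e -> `|p - K w| < e -> `|p - k *: w| < 2 * e.
  move=> kw pw; rewrite -(subrKA (K w)) (le_lt_trans (ler_normD _ _))//.
  by rewrite mulr_natl mulr2n ltrD.
exists p, k; split => //.
- apply: Ncl; apply/closure_normP => e e0.
  have e20 : 0 < e / 2 by rewrite divr_gt0.
  have [w [Nw _ kw pw _]] := approx _ e20; exists (k *: w); first exact: NZ.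
  by have := pv _ _ kw pw; rewrite mulrC divfK.
(* If p = 0, then k |w| < 2 e, whereas k - e < |Q w|^2 <= |w|; so k (k - e) < 2 e, and the [e]
   chosen below makes the two sides equal. *)
- apply/negP => /eqP p0.
  have k2 : 0 < 2 + k by rewrite addr_gt0.
  have e0 : 0 < k ^+ 2 / (2 + k) by rewrite divr_gt0 ?exprn_gt0.
  have [w [Nw w1 kw pw Qw]] := approx _ e0.
  have := pv _ _ kw pw; rewrite p0 sub0r normrN normrZ gtr0_norm// => kw2.
  have w2 : `|Q w| ^+ 2 <= `|w|.
    apply: (@le_trans _ _ (`|w| ^+ 2)); first by rewrite ler_pXn2r ?nnegrE.
    by rewrite -[leRHS]mulr1 expr2 ler_wpM2l.
  have := lt_le_trans Qw w2; rewrite -(ltr_pM2l k0) => /lt_trans/(_ kw2).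
  have -> : k * (k - k ^+ 2 / (2 + k)) = 2 * (k ^+ 2 / (2 + k)).
    by field; rewrite gt_eqF.
  by rewrite ltxx.
- apply/eqP; rewrite -subr_eq0 -normr_eq0 eq_le normr_ge0 andbT.
  apply/ler_addgt0Pr => e e0; rewrite add0r.
  have k2 : 0 < 2 + k by rewrite addr_gt0.
  have d0 : 0 < e / (2 + k) by rewrite divr_gt0.
  have [w [Nw w1 kw pw Qw]] := approx _ d0.
  (* The two terms are bounded by 2 d and k d with d = e / (2 + k), hence by [e] in total. *)
  have -> : P (Q p) - - k *: p = - (K (p - k *: w) - k *: (p - K w)).
    have KZ : K (k *: w) = k *: K w by rewrite /K !linearZ.
    rewrite KB KZ (scalerBr k p) (opprB (k *: p)) subrKA opprB.
    by rewrite /K scaleNr !opprK addrC.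
  rewrite normrN (le_trans (ler_normB _ _))//.
  apply: (@le_trans _ _ (2 * (e / (2 + k)) + k * (e / (2 + k)))).
    rewrite lerD ?(le_trans (normK _)) ?ltW ?pv// normrZ gtr0_norm//.
    by rewrite ltr_pM2l.
  by rewrite -mulrDl mulrC divfK// gt_eqF.
Qed.

(** An eigenvector [v] of (1 - S^2)^-1 for [k] satisfies S v = k^-1 Q v - v, so S v stays in [N],
    and S^2 v = (1 - k^-1) v = - w^2 v with w = |S v| / |v|. Then u = - S v / w; if S v = 0, take u
    = 0 and w = 0. *)
Lemma skew_oscillation z : N z -> z != 0 -> exists v u (w : R),
  [/\ N v, N u & v != 0] /\
  [/\ dom S v, dom S u, S v = - w *: u & S u = w *: v].
Proof.
move=> Nz /(skew_eigenvector Nz)[v [k [Nv v0 k0 PQv]]].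
have kn0 : k != 0 by rewrite gt_eqF.
have Dv : dom S v.
  have -> : v = - k^-1 *: P (Q v) by rewrite PQv scalerA mulrNN mulVf ?scale1r.
  exact: domZ.
have Sv : S v = k^-1 *: Q v - v.
  have := SP (Q v); rewrite PQv operatorZ// => E.
  have -> : S v = - k^-1 *: (- k *: S v) by rewrite scalerA mulrNN mulVf ?scale1r.
  rewrite E !scaleNr opprK scalerBr scalerA mulVf// scale1r.
  by rewrite opprB.
have DSv : dom S (S v) by rewrite Sv; apply: domB => //; exact: domZ.
have SSv : S (S v) = (1 - k^-1) *: v.
  rewrite {1}Sv operatorB//; last exact: domZ.
  rewrite operatorZ// SQ Sv scalerBr subrACA subrr sub0r opprB.
  by rewrite scalerBl scale1r.
have nSv : `|S v| ^+ 2 = (k^-1 - 1) * `|v| ^+ 2.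
  have := skew_inner Sskew DSv Dv; rewrite SSv innerZl !inner_norm => /eqP.
  by rewrite -eqr_oppLR -mulNr opprB => /eqP.
have [Sv0|Sv0] := eqVneq (S v) 0.
  exists v, 0, 0; split; split => //; first by case: Slin.
  - by rewrite oppr0 scale0r.
  - by have := operatorZ Slin 0 Dv; rewrite !scale0r.
have nv0 : `|v| != 0 by rewrite normr_eq0.
pose w := `|S v| / `|v|.
have w0 : w != 0 by rewrite mulf_neq0 ?invr_eq0 ?normr_eq0.
have w2 : w ^+ 2 = k^-1 - 1.
  by rewrite exprMn nSv exprVn mulfK// expf_neq0.
exists v, (- w^-1 *: S v), w; split; split => //.
- by apply: NZ; rewrite Sv; apply: NB => //; apply: NZ; exact: QN.
- exact: domZ.
- by rewrite scalerA mulrNN divff ?scale1r.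
- rewrite operatorZ// SSv scalerA -[1 - _]opprB -w2 mulrNN expr2 mulKf//.
Qed.

End SkewResolvents.

(** * First-order expansion and local boundedness of C0-semigroups *)

Lemma at_right0P (R : realType) (P : R -> Prop) :
  (\forall h \near (0 : R)^'+, P h) ->
  exists2 d, 0 < d & forall h, 0 < h < d -> P h.
Proof.
move=> [d /= d0 dP]; exists d => // h /andP[h0 hd]; apply: dP => //=.
by rewrite sub0r normrN gtr0_norm.
Qed.

Section Semigroups.
Variables (R : realType) (V : completeNormedModType R).
Variables (G : operator V V) (T : R -> {linear V -> V}).
Hypothesis TC0 : C0_semigroup T.

Lemma generator_error x (e : R) : generates G T -> dom G x -> 0 < e ->
  exists2 d, 0 < d & forall h, 0 < h < d -> `|T h x - (x + h *: G x)| <= h * e.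
Proof.
move=> GT Dx e0; have [/(_ (conj Dx erefl)) + _] := GT x (G x).
move=> /cvgrPdist_lt/(_ e e0)/at_right0P[d d0 dP]; exists d => // h hd.
have h0 : 0 < h by case/andP: hd.
have -> : T h x - (x + h *: G x) = h *: - (G x - h^-1 *: (T h x - x)).
  rewrite opprB scalerBr scalerA divff ?gt_eqF// scale1r.
  by rewrite opprD addrA.
by rewrite normrZ normrN gtr0_norm// ler_pM2l//; exact/ltW/dP.
Qed.

Let Tcont t : 0 <= t -> continuous (T t). Proof. by case: TC0 => + _ _ _; apply. Qed.
Let T0 x : T 0 x = x. Proof. by case: TC0 => _ ->. Qed.
Let TD s t x : 0 <= s -> 0 <= t -> T (s + t) x = T s (T t x).
Proof. by case: TC0 => _ _ TD _ s0 t0; rewrite TD. Qed.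

(** Otherwise there are times h_n tending to 0 at which T(h_n) stretches some vector by more than n.
    Strong continuity at 0 makes this family pointwise bounded, contradicting Banach-Steinhaus. *)
Lemma semigroup_bounded_near0 : exists d (c : R), [/\ 0 < d, 0 <= c &
  forall h x, 0 <= h <= d -> `|T h x| <= c * `|x|].
Proof.
apply: contrapT => nT.
have /choice[h hP] n : exists h, 0 <= h <= n.+1%:R^-1 /\
    exists x, n%:R * `|x| < `|T h x|.
  apply: contrapT => nh; apply: nT; exists n.+1%:R^-1, n%:R; split => //.
  move=> h x hn; rewrite leNgt; apply/negP => xh; apply: nh.
  by exists h; split => //; exists x.
have h0 n : 0 <= h n by case: (hP n) => /andP[].
have /(_ 1)[M MP] :
    uniform_bounded [set f | exists n, f = T (h n) :> (V -> V)].
  apply: Banach_Steinhauss.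
    move=> _ [n ->]; split; last by move=> a x y; rewrite linearP.
    move=> r; have /linear_bounded_continuous/linear_boundedP := Tcont (h0 n).
    move=> /pinfty_ex_gt0[M M0 MT]; exists (M * r) => x xr.
    by apply: (le_trans (MT x)); rewrite ler_pM2l.
  move=> x; have [_ _ _ /(_ x) /cvgrPdist_lt/(_ 1 ltr01)] := TC0.
  move=> /at_right0P[d d0 dP]; have [N _ NP] := near_infty_natSinv_lt (PosNum d0).
  (* From index [N] on, h_n < d yields the bound |x| + 1; the finitely many earlier norms are added
     up. *)
  exists (`|x| + 1 + \sum_(i < N) `|T (h i) x|) => _ [n ->].
  have [nN|Nn] := ltnP n N.
    rewrite (bigD1 (Ordinal nN))//= addrCA lerDl addr_ge0 ?addr_ge0//.
    by apply: sumr_ge0.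
  apply: (@le_trans _ _ (`|x| + 1)); last by rewrite lerDl sumr_ge0.
  have [->|hn0] := eqVneq (h n) 0; first by rewrite T0 lerDl.
  rewrite -[T _ x](subrK x) addrC (le_trans (ler_normD _ _))// lerD2l distrC.
  apply/ltW/dP; rewrite lt_neqAle eq_sym hn0 h0/=.
  by case: (hP n) => /andP[_ hn] _; apply: (le_lt_trans hn); exact: NP.
have [_ [x]] := hP (Num.truncn M).+1.
have [->|x0] := eqVneq x 0; first by rewrite linear0 normr0 mulr0 ltxx.
have nx0 : 0 < `|x| by rewrite normr_gt0.
rewrite ltNge => /negP; apply.
have := MP (T (h (Num.truncn M).+1)) (ex_intro _ _ erefl) (`|x|^-1 *: x).
rewrite linearZ !normrZ normfV normr_id mulVf ?gt_eqF// lexx => /(_ isT).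
rewrite ler_pdivrMl// mulrC => /le_trans; apply.
by rewrite ler_wpM2r//; apply: ltW; exact: truncnS_gt.
Qed.

(** The bound near 0 is iterated by the semigroup law; replacing [c] by c + 1 >= 1 makes its powers
    increase. *)
Lemma semigroup_bounded (t : R) : exists2 c : R, 0 <= c &
  forall h x, 0 <= h <= t -> `|T h x| <= c * `|x|.
Proof.
have [d [c [d0 c0 cP]]] := semigroup_bounded_near0.
pose c1 := c + 1; have c11 : 1 <= c1 by rewrite lerDr.
have step n : forall h x, 0 <= h <= n%:R * d -> `|T h x| <= c1 ^+ n.+1 * `|x|.
  have small h x k : 0 <= h <= d -> `|T h x| <= c1 ^+ k.+1 * `|x|.
    move=> /cP/le_trans; apply; rewrite ler_wpM2r//.
    by rewrite (@le_trans _ _ c1) ?lerDl// ler_eXnr.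
  elim: n => [|n IH] h x /andP[h0 hn].
    by apply: small; rewrite h0 (le_trans hn)// mul0r ltW.
  have [hd|dh] := leP h d; first by apply: small; rewrite h0.
  have -> : h = d + (h - d) by rewrite addrC subrK.
  rewrite TD ?(ltW d0)// ?subr_ge0 ?(ltW dh)// exprS -mulrA.
  apply: (@le_trans _ _ (c1 * `|T (h - d) x|)).
    by rewrite -[c1]expr1; apply: small; rewrite (ltW d0) lexx.
  rewrite ler_wpM2l ?(le_trans _ c11)//; apply: IH.
  by rewrite subr_ge0 (ltW dh) lerBlDr (le_trans hn)// -natr1 mulrDl mul1r.
exists (c1 ^+ (Num.truncn (t / d)).+2); first by rewrite exprn_ge0// (le_trans _ c11).
move=> h x /andP[h0 ht]; apply: step; rewrite h0 (le_trans ht)//.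
by rewrite -ler_pdivrMr// ltW// truncnS_gt.
Qed.

End Semigroups.

(** * Orbits that rotate in an invariant plane *)

Lemma derive_right_error (R : realType) (f : R -> R) (l e : R) :
  is_derive (0 : R) (1 : R) f l -> 0 < e ->
  exists2 d, 0 < d & forall h, 0 < h < d -> `|f h - (f 0 + h * l)| <= h * e.
Proof.
move=> [fD fl] e0; move: fD; rewrite /derivable => fD.
have fl' : h^-1 *: (f (h *: 1 + 0) - f 0) @[h --> (0 : R)^'] --> l.
  by rewrite -fl; exact: fD.
move/cvg_dnbhs_at_right/cvgrPdist_lt : fl' => /(_ e e0)/at_right0P[d d0 dP].
exists d => // h hd; have h0 : 0 < h by case/andP: hd.
have := dP h hd; rewrite addr0 -[h *: 1]/(h * 1) mulr1 -[_ *: _]/(_ * _) => /ltW.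
rewrite -(ler_pM2l h0) -{1}(gtr0_norm h0) -normrM distrC; apply: le_trans.
by rewrite le_eqVlt; apply/orP; left; apply/eqP; congr `|_|; field; rewrite gt_eqF.
Qed.

Section Rotation.
Variables (R : realType) (V : completeNormedModType R).
Variables (G : operator V V) (T : R -> {linear V -> V}) (w : R).
Hypotheses (TC0 : C0_semigroup T) (GT : generates G T).

(** Candidate for the orbit of [v] when G v = w u and G u = - w v; the orbit of [u] is then
    [rotation u (- v)]. *)
Definition rotation (v u : V) (s : R) := cos (w * s) *: v + sin (w * s) *: u.

Lemma rotationD v u s t :
  rotation v u (s + t) = cos (w * s) *: rotation v u t + sin (w * s) *: rotation u (- v) t.
Proof.
rewrite /rotation mulrDr cosD sinD !scalerDr !scalerDl !scalerN !scaleNr !scalerA.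
by rewrite [X in _ + X = _]addrC addrACA [X in _ + X = _]addrC.
Qed.

Lemma rotation_error v u (e : R) : dom G v -> G v = w *: u -> 0 < e ->
  exists2 d, 0 < d & forall h, 0 < h < d -> `|T h v - rotation v u h| <= h * e.
Proof.
move=> Dv Gv e0.
have m0 : 0 < 1 + `|v| + `|u| by rewrite ltr_pwDl// ltr_pwDl.
(* The errors on T(h) v, cos and sin enter with weights 1, |v| and |u|. *)
pose e' := e / (1 + `|v| + `|u|); have e'0 : 0 < e' by rewrite divr_gt0.
have dcos : is_derive (0 : R) (1 : R) (fun h => cos (w * h)) 0.
  apply: is_derive_eq.
  by rewrite mulr0 sin0 oppr0 mul0r.
have dsin : is_derive (0 : R) (1 : R) (fun h => sin (w * h)) w.
  apply: is_derive_eq.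
  by rewrite mulr0 cos0 mul1r /GRing.scale /= mulr1.
have [d1 d10 d1P] := generator_error GT Dv e'0.
have [d2 d20 d2P] := derive_right_error dcos e'0.
have [d3 d30 d3P] := derive_right_error dsin e'0.
exists (Num.min d1 (Num.min d2 d3)); first by rewrite !lt_min d10 d20.
move=> h /andP[h0]; rewrite !lt_min => /and3P[h1 h2 h3].
have {}d1P : `|T h v - (v + h *: G v)| <= h * e' by apply: d1P; rewrite h0.
have {}d2P : `|cos (w * h) - 1| <= h * e'.
  by have := d2P h; rewrite h0 h2 !mulr0 cos0 addr0; apply.
have {}d3P : `|sin (w * h) - h * w| <= h * e'.
  by have := d3P h; rewrite h0 h3 mulr0 sin0 add0r; apply.
have -> : T h v - rotation v u h = (T h v - (v + h *: G v)) -
    ((cos (w * h) - 1) *: v + (sin (w * h) - h * w) *: u).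
  rewrite !scalerBl scale1r addrACA -opprD -scalerA -Gv opprB.
  by rewrite subrKA.
apply: (le_trans (ler_normB _ _)).
apply: (@le_trans _ _ (h * e' + (h * e' * `|v| + h * e' * `|u|))).
  rewrite lerD// (le_trans (ler_normD _ _))// !normrZ.
  by rewrite lerD// ler_wpM2r.
rewrite le_eqVlt; apply/orP; left; apply/eqP.
by rewrite /e'; field; rewrite gt_eqF.
Qed.

(* T(t) v - rotation t is telescoped over a subdivision of [0, t]; bounding T on
   [0, t] is what requires Banach-Steinhaus. *)
Lemma semigroup_rotation v u t : dom G v -> dom G u ->
  G v = w *: u -> G u = - w *: v -> 0 <= t -> T t v = rotation v u t.
Proof.
move=> Dv Du Gv Gu t0.
have [T0 TD] : (forall x, T 0 x = x) /\
    (forall s t, 0 <= s -> 0 <= t -> forall x, T (s + t) x = T s (T t x)).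
  by case: TC0.
have r0 : rotation v u 0 = v.
  by rewrite /rotation mulr0 cos0 sin0 scale1r scale0r addr0.
have [c c0 cP] := semigroup_bounded TC0 t.
have Gu' : G u = w *: - v by rewrite scalerN -scaleNr.
apply/eqP; rewrite -subr_eq0 -normr_eq0 eq_le normr_ge0 andbT.
apply/ler_addgt0Pr => e e0; rewrite add0r.
(* The accumulated error will be 2 c t e'; adding 1 to [c] and [t] keeps the divisor positive. *)
have M0 : 0 < 2 * (c + 1) * (t + 1).
  by rewrite !mulr_gt0// ltr_wpDl.
have e'0 : 0 < e / (2 * (c + 1) * (t + 1)) by rewrite divr_gt0.
set e' := e / _ in e'0.
have [d1 d10 d1P] := rotation_error Dv Gv e'0.
have [d2 d20 d2P] := rotation_error Du Gu' e'0.
(* Each step moves time [h] from the semigroup to the rotation. By [rotationD] the local error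
   combines those of [v] and [u] with coefficients at most 1, and T(s) amplifies it by at most
   [c]. *)
have step h s k : 0 < h -> h < d1 -> h < d2 -> 0 <= s -> s + k%:R * h <= t ->
    `|T (s + k%:R * h) v - T s (rotation v u (k%:R * h))| <= k%:R * (c * (h * e' * 2)).
  move=> h0 h1 h2; elim: k s => [|k IH] s s0 st.
    by rewrite !mul0r addr0 r0 subrr normr0.
  have E : s + k.+1%:R * h = (s + h) + k%:R * h.
    by rewrite -natr1 mulrDl mul1r addrA addrAC.
  have kh0 : 0 <= k%:R * h by rewrite mulr_ge0// ltW.
  have kh : k.+1%:R * h = k%:R * h + h by rewrite -natr1 mulrDl mul1r.
  rewrite E kh -(subrKA (T (s + h) (rotation v u (k%:R * h)))).
  rewrite (le_trans (ler_normD _ _))// -[k.+1%:R]natr1 mulrDl lerD//.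
    by apply: IH; rewrite ?addr_ge0 ?(ltW h0)// -E.
  rewrite mul1r TD ?(ltW h0)// -linearB.
  have s1 : 0 <= s <= t.
    by rewrite s0 (le_trans _ st)// lerDl mulr_ge0// ltW.
  apply: (le_trans (cP _ _ s1)); rewrite ler_wpM2l//.
  rewrite rotationD /rotation linearD !linearZ /= opprD addrACA -!scalerBr.
  rewrite (le_trans (ler_normD _ _))// !normrZ mulr_natr mulr2n lerD//.
    rewrite -[leRHS]mul1r ler_pM//; first exact: cos_max.
    by apply: d1P; rewrite h0.
  rewrite -[leRHS]mul1r ler_pM//; first exact: sin_max.
  by apply: d2P; rewrite h0.
have [->|tn0] := eqVneq t 0; first by rewrite T0 r0 subrr normr0 ltW.
have tp : 0 < t by rewrite lt_neqAle eq_sym tn0.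
pose n := (Num.truncn (t / Num.min d1 d2)).+1.
have d0 : 0 < Num.min d1 d2 by rewrite lt_min d10.
have n0 : 0 < n%:R :> R by rewrite ltr0n.
have h0 : 0 < t / n%:R by rewrite divr_gt0.
have /andP[h1 h2] : (t / n%:R < d1) && (t / n%:R < d2).
  rewrite -lt_min ltr_pdivrMr// mulrC -ltr_pdivrMr//; exact: truncnS_gt.
have nt : n%:R * (t / n%:R) = t by rewrite mulrC divfK// gt_eqF.
have := step _ 0 n h0 h1 h2 (lexx _); rewrite add0r nt T0 => /(_ (lexx _)).
move=> /le_trans; apply.
have -> : n%:R * (c * (t / n%:R * e' * 2)) = 2 * c * t * e'.
  by field; rewrite gt_eqF.
rewrite /e' mulrCA ler_piMr ?(ltW e0)// ler_pdivrMr// mul1r.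
by rewrite ler_pM ?mulr_ge0// ?ler_pM2l ?lerDl.
Qed.

End Rotation.

(** * Resolvent invariance of the unobservable subspace *)

Section ContractionAnnihilator.
Variables (R : realType) (H : hilbertType R) (S : operator H H).
Variables (T : R -> {linear H -> H}) (Q : {linear H -> H}).
Hypotheses (Tcontr : contraction_semigroup T) (ST : generates S T).
Hypothesis rQ : is_resolvent S 1 Q.

(* Since S Q = Q - 1, T(h) Q z = (1 + h) Q z - h z + o(h), so the supremum s of
   |<b, T(t) Q z>| satisfies (1 + h) s <= s + o(h). *)
Lemma resolvent_annihilated b z :
  (forall t, 0 <= t -> inner b (T t z) = 0 :> R) ->
  forall t, 0 <= t -> inner b (T t (Q z)) = 0 :> R.
Proof.
have [TC0 Tle] := Tcontr; move=> bz.
have [DQ SQ] := resolvent_op z rQ; rewrite scale1r in SQ.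
have TD s t x : 0 <= s -> 0 <= t -> T (s + t) x = T s (T t x).
  by case: TC0 => _ _ TD _ s0 t0; rewrite TD.
pose E := [set `|inner b (T t (Q z))| | t in [set t | 0 <= t]].
have Esup : has_sup E.
  split; first by exists `|inner b (T 0 (Q z))|; exists 0 => /=.
  exists (`|b| * `|Q z|) => _ [t /= t0 <-].
  by rewrite (le_trans (cauchy_schwarz _ _))// ler_wpM2l// Tle.
have Ele t : 0 <= t -> `|inner b (T t (Q z))| <= sup E.
  by move=> t0; apply: sup_upper_bound => //; exists t.
have small (e : R) : 0 < e -> sup E <= `|b| * e.
  move=> e0; have [d d0 dP] := generator_error ST DQ e0.
  pose h := d / 2; have h0 : 0 < h by rewrite divr_gt0.
  have {}dP : `|T h (Q z) - (Q z + h *: (Q z - z))| <= h * e.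
    by rewrite -SQ; apply: dP; rewrite h0 ltr_pdivrMr// ltr_pMr// ltr1n.
  set r := T h (Q z) - _ in dP.
  have Tr : T h (Q z) = (1 + h) *: Q z - h *: z + r.
    rewrite scalerDl scale1r -(addrA (Q z)) -scalerBr /r.
    by rewrite [RHS]addrC subrK.
  have bound t : 0 <= t -> `|inner b (T t (Q z))| <= (sup E + `|b| * (h * e)) / (1 + h).
    move=> t0; rewrite ler_pdivlMr ?addr_gt0//.
    (* Apply T(t) to the expansion of T(h) Q z and pair with [b]: the term in T(t) z vanishes by
       assumption. *)
    have E1 : inner b (T t (Q z)) * (1 + h) =
        inner b (T (t + h) (Q z)) - inner b (T t r).
      rewrite TD ?(ltW h0)// Tr linearD linearB !linearZ /=.
      by rewrite !(innerDr, innerNr, innerZr) bz//; ring.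
    rewrite -[1 + h]gtr0_norm ?addr_gt0// -normrM E1.
    rewrite (le_trans (ler_normB _ _))// lerD//.
      by apply: Ele; rewrite addr_ge0// ltW.
    rewrite (le_trans (cauchy_schwarz _ _))// ler_wpM2l//.
    by rewrite (le_trans (Tle _ _ t0)).
  have : sup E <= (sup E + `|b| * (h * e)) / (1 + h).
    by apply: ge_sup; [case: Esup|move=> _ [t /= t0 <-]; exact: bound].
  rewrite ler_pdivlMr ?addr_gt0// mulrDr mulr1 lerD2l [leRHS]mulrCA.
  by rewrite [leLHS]mulrC ler_pM2l.
move=> t t0; apply/eqP; rewrite -normr_eq0 eq_le normr_ge0 andbT.
apply: (le_trans (Ele t t0)); apply/ler_addgt0Pr => e e0; rewrite add0r.
have b1 : 0 < `|b| + 1 by rewrite ltr_wpDl.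
apply: (le_trans (small (e / (`|b| + 1)) (divr_gt0 e0 b1))).
by rewrite mulrCA ler_piMr ?(ltW e0)// ler_pdivrMr// mul1r lerDl.
Qed.

End ContractionAnnihilator.

(** * Equality by density, Euclidean duality and the rank condition *)

Lemma dense_continuous_eq (R : realType) (V : normedModType R) (D : set V)
    (f g : V -> R) :
  dense D -> continuous f -> continuous g -> (forall x, D x -> f x = g x) ->
  forall x, f x = g x.
Proof.
move=> dD cf cg Dfg x; apply/eqP; rewrite -subr_eq0 -normr_eq0 eq_le normr_ge0 andbT.
apply/ler_addgt0Pr => e e0; rewrite add0r.
have cfg : (f \- g) @ x --> f x - g x by apply: cvgB; [exact: cf|exact: cg].
move/cvgrPdist_lt : cfg => /(_ e e0)/nbhs_ballP[d /= d0 dP].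
have [y Dy xy] := dense_normP x dD d0.
have := dP y; rewrite -ball_normE /= => /(_ xy).
by rewrite (Dfg y Dy) subrr subr0 => /ltW.
Qed.

Section DotProduct.
Variables (R : realType) (n : nat).

Lemma dotcvE (x y : 'cV[R]_n) : dotcv x y = (x^T *m y) 0 0.
Proof. by rewrite !mxE; apply: eq_bigr => i _; rewrite mxE. Qed.

Lemma dotcvDr (x y z : 'cV[R]_n) : dotcv x (y + z) = dotcv x y + dotcv x z.
Proof. by rewrite !dotcvE mulmxDr mxE. Qed.

Lemma dotcvZr (a : R) (x y : 'cV[R]_n) : dotcv x (a *: y) = a * dotcv x y.
Proof. by rewrite !dotcvE -scalemxAr mxE. Qed.

Lemma dotcv_inj (y z : 'cV[R]_n) : (forall x, dotcv x y = dotcv x z) -> y = z.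
Proof.
move=> yz; apply/colP => i.
have E (t : 'cV[R]_n) : dotcv (delta_mx i 0) t = t i 0.
  by rewrite dotcvE trmx_delta -rowE mxE.
by rewrite -!E yz.
Qed.

End DotProduct.

Lemma dotcv_mulmxl (R : realType) (m n : nat) (A : 'M[R]_(m, n)) x y :
  dotcv (A *m x) y = dotcv x (A^T *m y).
Proof. by rewrite !dotcvE trmx_mul mulmxA. Qed.

(* A left null vector [(y, - g)] of the block matrix at [mu = - i w] is read off
   its real and imaginary parts [y = a + i b], [g = g1 + i g2]. *)
Lemma full_row_rank_pencil (R : realType) (n m p : nat) (A : 'M[R]_n)
    (B : 'M[R]_(n, m)) (C : 'M[R]_(p, n)) (a b : 'cV[R]_n) (g1 g2 : 'cV[R]_p)
    (w : R) :
  A^T *m a - w *: b = C^T *m g1 -> A^T *m b + w *: a = C^T *m g2 ->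
  B^T *m a = 0 -> B^T *m b = 0 ->
  \rank (block_mx (complex_mx A - (Complex 0 (- w))%:M) (complex_mx B)
                  (complex_mx C) 0) = (n + p)%N ->
  g1 = 0 /\ g2 = 0.
Proof.
set L := block_mx _ _ _ _ => eA eB Ba Bb rk.
pose cplx k (x y : 'cV[R]_k) : 'cV[R[i]]_k := complex_mx x + 'i%C *: complex_mx y.
have cplxM k l (D : 'M[R]_(k, l)) x y :
    (complex_mx D)^T *m cplx k x y = cplx l (D^T *m x) (D^T *m y).
  by rewrite /cplx /complex_mx !map_mxM -map_trmx mulmxDr scalemxAr.
have cplx0 k (x y : 'cV[R]_k) : cplx k x y = 0 -> x = 0 /\ y = 0.
  move=> xy0; have E i : x i 0 = 0 /\ y i 0 = 0.
    move/matrixP : xy0 => /(_ i 0); rewrite !mxE => /eqP.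
    by rewrite eq_complex /= !(mul0r, mul1r, mulr0, subr0, addr0, add0r) => /andP[/eqP ? /eqP ?].
  by split; apply/colP => i; rewrite mxE; case: (E i).
have : row_mx (cplx n a b)^T (- (cplx p g1 g2)^T) *m L = 0.
  rewrite /L mul_row_block mulmx0 addr0.
  have -> : (cplx n a b)^T *m complex_mx B = 0.
    apply: trmx_inj; rewrite trmx_mul trmxK cplxM Ba Bb trmx0.
    by rewrite /cplx /complex_mx !map_mx0 scaler0 addr0.
  (* As - mu (a + i b) = - w b + i w a, the hypotheses [eA] and [eB] are the real and imaginary
     parts of this equation. *)
  have -> : (cplx n a b)^T *m (complex_mx A - (Complex 0 (- w))%:M)
      + - (cplx p g1 g2)^T *m complex_mx C = 0.
    apply: trmx_inj; rewrite trmx0 linearD /= !trmx_mul linearN /= !trmxK.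
    rewrite linearB /= tr_scalar_mx mulmxBl mulmxN !cplxM -eA -eB mul_scalar_mx.
    apply/colP => j; rewrite !mxE; apply/eqP; rewrite eq_complex /=.
    by apply/andP; split; apply/eqP; ring.
  by rewrite row_mx0.
have /row_free_inj Linj : row_free L by rewrite /row_free rk.
rewrite -(mul0mx _ L) => /Linj; rewrite -row_mx0 => /eq_row_mx[_].
move=> g0; apply: cplx0; apply: trmx_inj.
by rewrite trmx0 -[LHS]opprK g0 oppr0.
Qed.

(** * The duality pairing and the weak form of the Sylvester equation *)

Section Duality.
Variables (R : realType) (H : hilbertType R) (n p : nat).
Variables (A : 'M[R]_n) (C : 'M[R]_(p, n)) (S : operator H H).
Variables (Hm1 : completeNormedModType R) (iota Sm1 : {linear H -> Hm1}).
Variables (pairing : Hm1 -> H -> R) (Gamma : {linear 'cV[R]_p -> Hm1}).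
Variables (Gammas : H -> 'cV[R]_p) (M : {linear 'cV[R]_n -> H}).
Hypotheses (Slin : linear_operator S) (Sdense : densely_defined S).
Hypothesis Sskew : skew_adjoint S.
Hypotheses (iotadense : dense (range iota)) (SE : is_extension S iota Sm1).
Hypothesis pairingP : is_duality_pairing S iota pairing.
Hypothesis GammasP : is_dual_adjoint S pairing Gamma Gammas.

Let domadj w : dom S w -> dom (adjoint S) w.
Proof. by case: Sskew => ->. Qed.

(** [is_duality_pairing] gives continuity and the values on the image of [iota]; additivity follows
    by density, in one variable at a time. *)
Lemma pairingB w x y : dom S w -> pairing (x - y) w = pairing x w - pairing y w.
Proof.
move=> /domadj/pairingP[cw iw].
have step h : forall x, pairing (x - iota h) w = pairing x w - inner h w.
  apply: (dense_continuous_eq iotadense).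
  - move=> z; have subz : (fun z => z - iota h) @ z --> z - iota h.
      by apply: cvgB; [exact: cvg_id|exact: cvg_cst].
    exact: (cvg_comp _ _ subz (cw _)).
  - by move=> z; apply: cvgB; [exact: cw|exact: cvg_cst].
  - by move=> _ [k _ <-]; rewrite -linearB !iw innerBl.
apply: (dense_continuous_eq (f := fun y => pairing (x - y) w)
  (g := fun y => pairing x w - pairing y w) iotadense).
- move=> z; have subz : (fun z => x - z) @ z --> x - z.
    by apply: cvgB; [exact: cvg_cst|exact: cvg_id].
  exact: (cvg_comp _ _ subz (cw _)).
- by move=> z; apply: cvgB; [exact: cvg_cst|exact: cw].
- by move=> _ [k _ <-]; rewrite step iw.
Qed.

Lemma pairingN w x : dom S w -> pairing (- x) w = - pairing x w.
Proof.
move=> Dw; have [_ iw] := pairingP (domadj Dw).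
by rewrite -sub0r pairingB// -(linear0 iota) iw inner0l sub0r.
Qed.

(** By density the pairing is linear in its second argument on [dom S], and so is [Gammas]. Rotating
    orbits consist of such combinations. *)
Lemma Gammas_ker_comb (a b : R) v u : dom S v -> dom S u ->
  Gammas v = 0 -> Gammas u = 0 -> Gammas (a *: v + b *: u) = 0.
Proof.
move=> Dv Du Gv Gu; apply: dotcv_inj => e.
have D0 (z : 'cV[R]_p) : dotcv z 0 = 0 by rewrite dotcvE mulmx0 mxE.
have Dc : dom S (a *: v + b *: u) by apply: domD => //; exact: domZ.
rewrite -(GammasP (domadj Dc)).
have -> : pairing (Gamma e) (a *: v + b *: u) =
    a * pairing (Gamma e) v + b * pairing (Gamma e) u.
  have [[cc ic] [cv iv] [cu iu]] := And3 (pairingP (domadj Dc))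
    (pairingP (domadj Dv)) (pairingP (domadj Du)).
  apply: (dense_continuous_eq (f := pairing ^~ _)
    (g := fun x => a * pairing x v + b * pairing x u) iotadense) => //.
  - move=> z; apply: cvgD; apply: cvgM; first [exact: cvg_cst|exact: cv|exact: cu].
  - by move=> _ [h _ <-]; rewrite ic iv iu innerDr !innerZr.
by rewrite !GammasP ?Gv ?Gu ?D0 ?mulr0 ?addr0//; exact: domadj.
Qed.

Hypothesis Sylvester : forall x : 'cV[R]_n,
  Sm1 (M x) - iota (M (A *m x)) = - Gamma (C *m x).

(** Pair the Sylvester equation with [w]: on [dom S] the pairing of [Sm1 h] with [w] is - <h, S w>
    by skew-adjointness, hence for all [h] by density. *)
Lemma sylvester_weak w x : dom S w ->
  inner (M x) (S w) + inner (M (A *m x)) w = dotcv (C *m x) (Gammas w).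
Proof.
move=> Dw; have [cw iw] := pairingP (domadj Dw).
have Sw : forall h, pairing (Sm1 h) w = - inner h (S w).
  case: SE => cS ES.
  apply: (dense_continuous_eq Sdense).
  - by move=> h; exact: (cvg_comp _ _ (cS h) (cw _)).
  - by move=> h; apply: cvgN; exact: continuous_innerl.
  - by move=> h Dh; rewrite ES// iw (skew_inner Sskew Dh Dw).
have := congr1 (pairing ^~ w) (Sylvester x).
rewrite pairingB// pairingN// Sw iw (GammasP (domadj Dw)) => /eqP.
by rewrite -opprD eqr_opp => /eqP.
Qed.

End Duality.

(** * The unobservable subspace is closed; conclusion *)

Lemma closed_annihilator (R : realType) (H : hilbertType R) (I : Type) (b : I -> H)
    (T : R -> {linear H -> H}) : contraction_semigroup T ->
  closure [set z | forall i t, 0 <= t -> inner (b i) (T t z) = 0 :> R] `<=`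
    [set z | forall i t, 0 <= t -> inner (b i) (T t z) = 0].
Proof.
move=> [_ Tle] z /closure_normP clz i t t0.
apply/eqP; rewrite -normr_eq0 eq_le normr_ge0 andbT.
apply/ler_addgt0Pr => e e0; rewrite add0r.
have b1 : 0 < `|b i| + 1 by rewrite ltr_wpDl.
have [y /(_ i t t0) by0 zy] := clz _ (divr_gt0 e0 b1).
have -> : inner (b i) (T t z) = inner (b i) (T t (z - y)).
  by rewrite linearB innerBr by0 subr0.
rewrite (le_trans (cauchy_schwarz _ _))//.
apply: (@le_trans _ _ (`|b i| * (e / (`|b i| + 1)))).
  by rewrite ler_wpM2l// (le_trans (Tle _ _ t0))// ltW.
by rewrite mulrCA ler_piMr ?(ltW e0)// ler_pdivrMr// mul1r lerDl.
Qed.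

Theorem proposition1 (R : realType) (H : hilbertType R) (n m p : nat)
  (A : 'M[R]_n) (B : 'M[R]_(n, m)) (C : 'M[R]_(p, n))
  (S : operator H H) (T : R -> {linear H -> H})
  (* the space H_{-1}, the extension S : H -> H_{-1}, the duality pairing *)
  (beta : R) (Hm1 : completeNormedModType R) (iota Sm1 : {linear H -> Hm1})
  (pairing : Hm1 -> H -> R)
  (Gamma : {linear 'cV[R]_p -> Hm1}) (Gammas : H -> 'cV[R]_p)
  (M : {linear 'cV[R]_n -> H}) (Ms : H -> 'cV[R]_n) :
  linear_operator S ->
  densely_defined S ->
  is_extrapolation_space S iota beta ->
  is_extension S iota Sm1 ->
  is_duality_pairing S iota pairing ->
  continuous Gamma ->
  is_dual_adjoint S pairing Gamma Gammas ->
  (* (i) *)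
  contraction_semigroup T ->
  generates S T ->
  (* (ii) *)
  Hurwitz A ->
  (* (iii) *)
  spectrum (complexify_op S) `&` mx_spectrum A = set0 ->
  spectrum (complexify_op S) !=set0 ->
  mx_spectrum A !=set0 ->
  (* Sylvester equation S M - M A = - Gamma C in H_{-1} *)
  continuous M ->
  (forall x : 'cV[R]_n,
    Sm1 (M x) - iota (M (A *m x)) = - Gamma (C *m x)) ->
  is_adjoint_cv M Ms ->
  (* (vi) *)
  skew_adjoint S ->
  compact_resolvent S ->
  (* (vii) *)
  approx_observable (adjoint S) Gammas ->
  (* (viii) *)
  (forall mu : R[i], is_eigenvalue (complexify_op S) mu ->
    \rank (block_mx (complex_mx A - mu%:M) (complex_mx B)
                    (complex_mx C) 0) = (n + p)%N) ->
  approx_observable S (fun h => B^T *m Ms h).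
Proof.
move=> Slin Sdense [Qb [rQb _ iotadense]] SE pairingP _ GammasP Tcontr ST _ _ _ _ _
  Sylvester MsP Sskew [l [L [rL Lco]]] [T' [T'C0 GT' T'obs]] rank_cond.
exists T; split => //; first by case: Tcontr.
move=> z Dz z_unobs; apply: contrapT => /eqP z0.
(* B^T M^* is the adjoint of M B, so unobservability is tested against the vectors [M (B *m y)]. *)
pose N := [set x | forall (y : 'cV[R]_m) t, 0 <= t ->
  inner (M (B *m y)) (T t x) = 0 :> R].
have [Q rQ] := skew_resolvent Slin Sdense Sskew (oner_neq0 R).
have [P rP] : exists P : {linear H -> H}, is_resolvent S (- 1) P.
  by apply: skew_resolvent => //; rewrite oppr_eq0 oner_eq0.
have Qcompact := resolvent_seq_compact Sskew rQ rL Lco.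
have N0 : N 0 by move=> y t t0; rewrite linear0 inner0r.
have Nlin (a : R) x y : N x -> N y -> N (a *: x + y).
  move=> Nx Ny e t t0.
  by rewrite linearP innerDr innerZr Nx// Ny// mulr0 addr0.
have QN x : N x -> N (Q x).
  by move=> Nx y; apply: (resolvent_annihilated Tcontr ST rQ) => t; exact: Nx.
have Nz : N z.
  by move=> y t t0; rewrite MsP dotcv_mulmxl z_unobs// dotcvE mulmx0 mxE.
have Ncl : closure N `<=` N by exact: closed_annihilator.
have [v [u [w [[Nv Nu v0] [Dv Du Sv Su]]]]] :=
  skew_oscillation Slin Sskew rQ rP Qcompact Ncl Nlin N0 QN Nz z0.
(* This is the condition defining [N] at t = 0. *)
have BMs x : N x -> B^T *m Ms x = 0.
  move=> /(_ _ 0 (lexx _)); have -> : T 0 x = x by case: Tcontr => -[_ ->].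
  move=> Nx; apply: dotcv_inj => y.
  by rewrite -dotcv_mulmxl -MsP Nx dotcvE mulmx0 mxE.
have weak x y : dom S x -> inner (M y) (S x) + inner (M (A *m y)) x
    = dotcv (C *m y) (Gammas x).
  exact: (sylvester_weak Sdense Sskew iotadense SE pairingP GammasP Sylvester).
have eA : A^T *m Ms v - w *: Ms u = C^T *m Gammas v.
  apply: dotcv_inj => y; rewrite -dotcv_mulmxl -weak// Sv innerZr !MsP.
  by rewrite dotcv_mulmxl -scaleNr dotcvDr dotcvZr addrC.
have eB : A^T *m Ms u + w *: Ms v = C^T *m Gammas u.
  apply: dotcv_inj => y; rewrite -dotcv_mulmxl -weak// Su innerZr !MsP.
  by rewrite dotcv_mulmxl dotcvDr dotcvZr addrC.
(* S (v - i u) = - w u - i w v = - i w (v - i u). *)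
have mu : is_eigenvalue (complexify_op S) (Complex 0 (- w)).
  have S0 : dom S 0 by case: Slin.
  have SNu : S (- u) = - S u.
    by rewrite -scaleN1r operatorZ// scaleN1r.
  exists (Complexification v (- u)); split.
  - by split => //=; rewrite -sub0r; exact: domB.
  - by apply: contra_neq v0 => -[].
  - congr Complexification => /=.
      by rewrite scale0r sub0r scalerN opprK Sv.
    by rewrite scale0r add0r SNu Su scaleNr.
have [Gv Gu] := full_row_rank_pencil eA eB (BMs v Nv) (BMs u Nu) (rank_cond _ mu).
case: (Sskew) => domE adjE.
move: v0; rewrite (T'obs v) ?eqxx ?domE// => t t0.
(* With S^* = - S, the signs become those of [semigroup_rotation]: S^* v = w u and S^* u = - w v. *)
have -> : T' t v = rotation w v u t.
  apply: (semigroup_rotation T'C0 GT') => //; rewrite ?domE//.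
  - by rewrite adjE// Sv scaleNr opprK.
  - by rewrite adjE// Su scaleNr.
exact: (Gammas_ker_comb Slin Sskew iotadense pairingP GammasP).
Qed.
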